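(* Consider Gaussian distributed data ($F_1$ and $F_2$ are $p$-variate normal), under Assumptions 1B, 2, 4 and 5 listed in the context. For any $\tau>0$ (the constant in Assumption 2), any $0<\omega<1-\alpha$, and any $\beta$ with $\max\{2/3,(3-\xi)/4\}<\beta<1$, there exists a constant $c_0>0$ such that, as $n,p\to\infty$, $$\sup_{W_\alpha\in\mathcal W_\alpha}\ \inf_{(\boldsymbol\Sigma_1,\boldsymbol\Sigma_2)\in\underline{\mathcal C}(\beta,c_0)}P(W_\alpha=1)\le 1-\omega .$$
   Context: Data. $\mathbf X_1,\dots,\mathbf X_{n_1}$ are i.i.d. from a distribution $F_1$ on $\mathbb R^p$, $\mathbf Y_1,\dots,\mathbf Y_{n_2}$ are i.i.d. from a distribution $F_2$ on $\mathbb R^p$, and the two samples are independent; $\mathbf X_k=(X_{k1},\dots,X_{kp})^{T}$, $\mathbf Y_k=(Y_{k1},\dots,Y_{kp})^{T}$. The means are $(\mu_{11},\dots,\mu_{1p})^T$, $(\mu_{21},\dots,\mu_{2p})^T$, the covariance matrices are $\boldsymbol\Sigma_1=(\sigma_{ij1})$, $\boldsymbol\Sigma_2=(\sigma_{ij2})$, and the correlation matrices are $(\rho_{ij1})$, $(\rho_{ij2})$. Put $\delta_{ij}=\sigma_{ij1}-\sigma_{ij2}$, $q=p(p+1)/2$, $n=n_1n_2/(n_1+n_2)$, and $\kappa=\lim n_1/(n_1+n_2)$ (assumed to exist). Parameters. $\theta_{ij1}=\mathrm{var}\{(X_{ki}-\mu_{1i})(X_{kj}-\mu_{1j})\}$,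 $\theta_{ij2}=\mathrm{var}\{(Y_{ki}-\mu_{2i})(Y_{kj}-\mu_{2j})\}$, $\rho^{(1)}_{ij,lm}=\mathrm{Cor}\{(X_{ki}-\mu_{1i})(X_{kj}-\mu_{1j}),(X_{kl}-\mu_{1l})(X_{km}-\mu_{1m})\}$, and $\rho^{(2)}_{ij,lm}$ is defined likewise from $\mathbf Y_k$. Hypotheses. $H_0:\boldsymbol\Sigma_1=\boldsymbol\Sigma_2$. The sparse and faint alternative $H_a$ with sparsity parameter $\beta$: exactly $m_a=\lfloor q^{1-\beta}\rfloor$ of the $\delta_{ij}$, $i\le j$, are nonzero, and each nonzero one is written $\delta_{ij}=\sqrt{2r_{0,ij}\log(q)/n}$ with $r_{0,ij}>0$. Tests. Fix a level $\alpha\in(0,1)$. $\mathcal W_\alpha$ is the collection of all $\alpha$-level tests $W_\alpha\in\{0,1\}$ (value 1 meaning rejection) of $H_0:\boldsymbol\Sigma_1=\boldsymbol\Sigma_2$ versus $\boldsymbol\Sigma_1\ne\boldsymbol\Sigma_2$ under Gaussian distributions and Assumptions 2, 4 and 5, i.e. $P(W_\alpha=1\mid H_0)\le\alpha$. Class. $\underline{\mathcal C}(\beta,c)$ is the set of pairs $(\boldsymbol\Sigma_1,\boldsymbol\Sigma_2)$ under $H_a$ above with $m_a=\lfloor q^{1-\beta}\rfloor$ and $r_{0,ij}\ge c$ for all $(i,j)$ with $\sigma_{ij1}\ne\sigma_{ij2}$, satisfying Assumptions 2, 4 and 5. Convention: $a_n\sim b_n$ means $c_1\le a_n/b_n\le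 c_2$ for all $n$, for some constants $c_1,c_2>0$. Assumptions. 1B: as $n\to\infty$, $p\to\infty$ with $n\sim p^{\xi}$ for some $\xi\in(0,2)$. 2: there is a constant $\tau>0$ with $\tau<\min_i\{\sigma_{ii1},\sigma_{ii2}\}\le\max_i\{\sigma_{ii1},\sigma_{ii2}\}<\tau^{-1}$ and $\min_{i,j}\{\theta_{ij1}/(\sigma_{ii1}\sigma_{jj1}),\theta_{ij2}/(\sigma_{ii2}\sigma_{jj2})\}>\tau$. 4: there is a small constant $\rho_0>0$ such that $\max\{|\rho_{ij1}|,|\rho_{ij2}|\}<1-\rho_0$ for all $i\ne j$, and $\max\{|\rho^{(1)}_{ij,lm}|,|\rho^{(2)}_{ij,lm}|\}<1-\rho_0$ for all $(i,j)\neq(l,m)$ with $i\le j$, $l\le m$. 5: there is a permutation of the coordinates $\{1,\dots,p\}$ (the same for both samples, not necessarily known) such that, after permuting, the coordinate sequences $\{X_{kj}\}_{j=1}^p$ and $\{Y_{kj}\}_{j=1}^p$ are $\beta$-mixing with coefficients satisfying $\max\{\zeta_{x,p}(h),\zeta_{y,p}(h)\}\le C\gamma^h$ for constants $C>0$, $\gamma\in(0,1)$, every $p\in\mathbb Z^+$ and every positive integer $h\le p-1$. Here $\zeta_{x,p}(h)=\sup_{1\le m\le p-h}\zeta(\sigma\{X_{kj}:1\le j\le m\},\sigma\{X_{kj}:m+h\le j\le p\})$, $\zeta_{y,p}$ is defined likewise, and $\zeta(\mathcal A,\mathcal B)=\frac12\sup\sum_{l_1=1}^{u_1}\sum_{l_2=1}^{u_2}|P(A_{l_1}\cap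 B_{l_2})-P(A_{l_1})P(B_{l_2})|$, the supremum being over all finite partitions $\{A_{l_1}\}\subset\mathcal A$, $\{B_{l_2}\}\subset\mathcal B$ of the sample space. *)

(* Defs.v *)
From HB Require Import structures.
From mathcomp Require Import all_boot all_order all_algebra all_fingroup.
From mathcomp Require Import all_classical all_reals all_analysis measurable_realfun.

Set Implicit Arguments.
Unset Strict Implicit.
Unset Printing Implicit Defensive.

Import Order.TTheory GRing.Theory Num.Def Num.Theory.
Import numFieldTopology.Exports numFieldNormedType.Exports.

Local Open Scope classical_set_scope.
Local Open Scope ring_scope.

(* A distribution on R^p is a probability on [p.-tuple R], whose library
   sigma-algebra is the product Borel one. *)

Section iid_law.
Context d (T : measurableType d) (R : realType).

Definition tcons n (x : T * n.-tuple T) : n.+1.-tuple T :=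
  [the n.+1.-tuple T of x.1 :: x.2].

Lemma measurable_tcons n : measurable_fun [set: T * n.-tuple T] (@tcons n).
Proof. exact: measurable_cons. Qed.

HB.instance Definition _ n := isMeasurableFun.Build _ _ _ _ (@tcons n)
  (@measurable_tcons n).

(* Law of an i.i.d. sample of size n from F. *)
Fixpoint iid_law (F : probability T R) n : probability (n.-tuple T) R :=
  match n with
  | 0 => dirac ([tuple] : 0.-tuple T)
  | n'.+1 => distribution (F \x iid_law F n')%E
               (@tcons n' : {mfun (T * n'.-tuple T)%type >-> n'.+1.-tuple T})
  end.

End iid_law.

Section std_normal.
Context (R : realType).

Definition Borel_id : measurableTypeR R -> R := idfun.

HB.instance Definition _ := @isMeasurableFun.Build _ _ _ _ Borel_id
  (@measurable_id _ _ setT).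

(* [normal_prob] lives on [measurableTypeR R]; [Borel_id] moves it to the same
   sigma-algebra under the display of R. *)
Definition std_normal : probability R R :=
  distribution (@normal_prob R 0 1 : probability (measurableTypeR R) R)
    (Borel_id : {mfun measurableTypeR R >-> R}).

End std_normal.

Section normal_vectors.
Context (R : realType) (p : nat).

Definition affine (mu : p.-tuple R) (A : 'M[R]_p) (z : p.-tuple R) :
    p.-tuple R :=
  [tuple tnth mu i + \sum_(j < p) A i j * tnth z j | i < p].

Lemma measurable_affine mu A : measurable_fun [set: p.-tuple R] (affine mu A).
Proof.
apply/measurable_fun_tnthP => i.
rewrite [X in measurable_fun _ X](_ : _ =
  (fun z => tnth mu i + \sum_(j < p) A i j * tnth z j)); last first.
  by apply/funext => z /=; rewrite tnth_mktuple.
apply: measurable_funD => //; apply: measurable_sum => j.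
by apply: measurable_funM => //; exact: measurable_tnth.
Qed.

HB.instance Definition _ mu A := isMeasurableFun.Build _ _ _ _ (affine mu A)
  (@measurable_affine mu A).

(* F = N_p(mu, Sigma): the law of mu + A Z, where A A^T = Sigma and Z has
   independent standard normal coordinates. *)
Definition is_normal (mu : p.-tuple R) (Sigma : 'M[R]_p)
    (F : probability (p.-tuple R) R) : Prop :=
  exists A : 'M[R]_p, A *m A^T = Sigma /\
    forall B, measurable B ->
      F B = distribution (iid_law (std_normal R) p)
              (affine mu A : {mfun p.-tuple R >-> p.-tuple R}) B.

End normal_vectors.

Section parameters.
Context (R : realType) (p : nat).
Implicit Types (F : probability (p.-tuple R) R) (i j l m : 'I_p).

Definition coord i (x : p.-tuple R) : R := tnth x i.

Definition correlation F (X Y : p.-tuple R -> R) : R :=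
  fine (covariance F X Y) /
  (Num.sqrt (fine 'V_F[X]) * Num.sqrt (fine 'V_F[Y])).

Definition mean F i : R := fine 'E_F[coord i].

Definition sigma F i j : R := fine (covariance F (coord i) (coord j)).

Definition rho F i j : R := correlation F (coord i) (coord j).

Definition cprod F i j (x : p.-tuple R) : R :=
  (coord i x - mean F i) * (coord j x - mean F j).

Definition theta F i j : R := fine 'V_F[cprod F i j].

Definition rho4 F i j l m : R := correlation F (cprod F i j) (cprod F l m).

End parameters.

Section beta_mixing.
Context (R : realType).

(* The coefficient zeta(AA, BB) under P. *)
Definition beta_coef d (T : measurableType d) (P : probability T R)
    (AA BB : set (set T)) : \bar R :=
  ((2^-1)%:E * ereal_sup
    [set r | exists u1 u2 (A : 'I_u1 -> set T) (B : 'I_u2 -> set T),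
      [/\ (forall k, AA (A k)) /\ partition [set: 'I_u1] A [set: T],
          (forall k, BB (B k)) /\ partition [set: 'I_u2] B [set: T] &
          r = \sum_(k < u1) \sum_(k' < u2)
                `|P (A k `&` B k') - P (A k) * P (B k')|]])%E.

Definition sigma_coord p (J : set 'I_p) : set (set (p.-tuple R)) :=
  <<s \bigcup_(j in J) preimage_set_system [set: p.-tuple R] (@coord R p j)
        measurable >>.

(* The coefficient zeta_p(h) of the coordinate sequence permuted by s, whose
   j-th term is coordinate s j.  Ordinals count from 0, so the terms 1, ..., m
   of the sequence are the j < m, and the terms m + h, ..., p are the j with
   m + h <= j + 1. *)
Definition zeta p (F : probability (p.-tuple R) R) (s : 'S_p) (h : nat) :
    \bar R :=
  ereal_sup [set beta_coef F
      (sigma_coord [set s j | j in [set j : 'I_p | (j < m)%N]])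
      (sigma_coord [set s j | j in [set j : 'I_p | (m + h <= j.+1)%N]])
    | m in [set m | (1 <= m <= p - h)%N]].

End beta_mixing.

Section assumptions.
Context (R : realType) (p : nat).
Implicit Types F : probability (p.-tuple R) R.

Definition assumption2 (tau : R) F1 F2 : Prop :=
  forall F, F = F1 \/ F = F2 ->
    (forall i, tau < sigma F i i < tau^-1) /\
    (forall i j, tau < theta F i j / (sigma F i i * sigma F j j)).

Definition assumption4 (rho0 : R) F1 F2 : Prop :=
  forall F, F = F1 \/ F = F2 ->
    (forall i j, i != j -> `|rho F i j| < 1 - rho0) /\
    (forall i j l m : 'I_p, (i <= j)%N -> (l <= m)%N -> (i, j) != (l, m) ->
      `|rho4 F i j l m| < 1 - rho0).

Definition assumption5 (C gamma : R) F1 F2 : Prop :=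
  exists s : 'S_p, forall h, (1 <= h <= p.-1)%N ->
    (Order.max (zeta F1 s h) (zeta F2 s h) <= (C * gamma ^+ h)%:E)%E.

Definition assumptions245 tau rho0 C gamma F1 F2 : Prop :=
  [/\ assumption2 tau F1 F2, assumption4 rho0 F1 F2 &
      assumption5 C gamma F1 F2].

End assumptions.

Section testing.
Context (R : realType) (p n1 n2 : nat) (tau rho0 C gamma : R).

Definition eff_size : R := (n1 * n2)%:R / (n1 + n2)%:R.

Definition nb_cov : nat := ((p * p.+1) %/ 2)%N.

(* P(W = 1) when the samples are drawn from F1 and F2. *)
Definition reject_prob (F1 F2 : probability (p.-tuple R) R)
    (W : n1.-tuple (p.-tuple R) * n2.-tuple (p.-tuple R) -> bool) : \bar R :=
  (iid_law F1 n1 \x iid_law F2 n2)%E [set s | W s].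

(* The null hypothesis is composite: the two mean vectors and the common
   covariance matrix are free. *)
Definition level_tests (alpha : R) :
    set {mfun (n1.-tuple (p.-tuple R) * n2.-tuple (p.-tuple R))%type >-> bool} :=
  [set W | forall (mu1 mu2 : p.-tuple R) (Sigma : 'M[R]_p) F1 F2,
    is_normal mu1 Sigma F1 -> is_normal mu2 Sigma F2 ->
    assumptions245 tau rho0 C gamma F1 F2 ->
    (reject_prob F1 F2 W <= alpha%:E)%E].

Definition sparse_faint (beta c : R) (Sigma1 Sigma2 : 'M[R]_p) : Prop :=
  let delta i j := Sigma1 i j - Sigma2 i j in
  let q := nb_cov%:R in
  #|[set ij : 'I_p * 'I_p | (ij.1 <= ij.2)%N && (delta ij.1 ij.2 != 0)]%SET|
    = Num.truncn (q `^ (1 - beta)) /\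
  forall i j : 'I_p, (i <= j)%N -> delta i j != 0 ->
    exists r0 : R, [/\ 0 < r0, c <= r0 &
      delta i j = Num.sqrt (2 * r0 * ln q / eff_size)].

Definition alt_class (mu1 mu2 : p.-tuple R) (beta c : R) :
    set ('M[R]_p * 'M[R]_p) :=
  [set S | sparse_faint beta c S.1 S.2 /\
    exists F1 F2, [/\ is_normal mu1 S.1 F1, is_normal mu2 S.2 F2 &
      assumptions245 tau rho0 C gamma F1 F2]].

(* inf over alt_class of P(W = 1); [is_normal] determines F1 and F2 from S, as
   measures, so each S contributes one value. *)
Definition min_power (mu1 mu2 : p.-tuple R) (beta c : R)
    (W : n1.-tuple (p.-tuple R) * n2.-tuple (p.-tuple R) -> bool) : \bar R :=
  ereal_inf [set r | exists S F1 F2,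
    [/\ alt_class mu1 mu2 beta c S, is_normal mu1 S.1 F1,
        is_normal mu2 S.2 F2 & r = reject_prob F1 F2 W]].

Definition maximin_power (alpha : R) (mu1 mu2 : p.-tuple R) (beta c : R) :
    \bar R :=
  ereal_sup [set min_power mu1 mu2 beta c W | W in level_tests alpha].

End testing.

Section asymptotics.
Context (R : realType).

(* The asymptotics are those of a sequence of problems (n1 k, n2 k, p k); the
   constants of n ~ p^xi do not depend on k. *)
Definition assumption1B (xi : R) (n1 n2 p : nat -> nat) : Prop :=
  let n k := eff_size R (n1 k) (n2 k) in
  [/\ n @ \oo --> +oo, p @ \oo --> \oo &
      exists c1 c2 : R, [/\ 0 < c1, 0 < c2 &
        forall k, c1 <= n k / (p k)%:R `^ xi <= c2]].

End asymptotics.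

(* Main.v *)
(* Second moment method.  Both samples are standard normal under the null; under
   the alternative the smaller of the two samples gets correlation +-delta along
   the edges of a random matching.  The coordinates are cut into m = floor(q^(1-beta))
   groups of 2g coordinates, g ~ p/(2m), and each group carries one edge, uniform
   among g^2 candidates.  The likelihood ratios of two edges are uncorrelated
   unless the edges coincide, where the second moment is 1/(1-delta^2); hence the
   mixture likelihood of a sample of size N has second moment
     (1 + ((1-delta^2)^-N - 1)/g^2)^m,
   and since N <= 2n and delta^2 = 2 c0 log(q)/n this tends to 1 when beta > 2/3
   and c0 = (3 beta - 2)/16.  The alternatives satisfy Assumptions 2, 4 and 5
   because delta tends to 0 and, with matched coordinates put next to each other,
   the sequence is 1-dependent.

   Gaussian computations rest on one fact: the law of the pair (Z1, d Z1 + s Z2),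
   d^2 + s^2 = 1, has an explicit density that is symmetric in its arguments. *)

Require Import Defs.
From HB Require Import structures.
From mathcomp Require Import all_boot all_order all_algebra all_fingroup.
From mathcomp Require Import all_classical all_reals all_analysis measurable_realfun.
From mathcomp Require Import ring lra zify.

Set Implicit Arguments.
Unset Strict Implicit.
Unset Printing Implicit Defensive.

Import Order.TTheory GRing.Theory Num.Def Num.Theory.
Import numFieldTopology.Exports numFieldNormedType.Exports.

Local Open Scope classical_set_scope.
Local Open Scope ring_scope.

(** * I.i.d. laws and resampling of coordinates *)

(** The constants come from an exponent count. Put u = 3 beta - 2. The second moment is at most
    exp(m T / g^2), with T = (1 - delta^2)^-N. Since m <= p^(2(1 - beta)) and g >= p / (4m), the
    factor m / g^2 is at most 16 m^3 / p^2 <= 16 p^(-2u), which tends to 0 as soon as u > 0. On the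
    other hand T <= exp(2 N delta^2) <= exp(4 n delta^2) = q^(8 c0) <= p^(16 c0), so c0 = u / 16
    spends exactly half of that gain and leaves p^(-u). The groups turn the random matching into
    independent uniform choices, one per group. The sum of the overlaps over all pairs of matchings
    then factorises, and no combinatorics of random matchings is involved. It is the smaller sample
    that must be perturbed: min(n1, n2) <= 2n holds for every ratio n1 / n2, while the larger sample
    size is not bounded by a multiple of n. The other sample is integrated out, which turns the test
    into a randomised one-sample test. The worst-case power is at most the average power over the
    family, so some single alternative inherits the mixture bound. *)

Lemma measurable_tuple_comp d1 (X : measurableType d1) d (T : measurableType d)
    n (i : 'I_n) (f : X -> n.-tuple T) :
  measurable_fun setT f -> measurable_fun setT (fun x => tnth (f x) i).
Proof. by move=> mf; exact: measurableT_comp (measurable_tnth i) mf. Qed.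

Section iid_integral.
Context d (T : measurableType d) (R : realType) (F : probability T R).
Local Open Scope ereal_scope.

Lemma integral_iid_lawS n (f : n.+1.-tuple T -> \bar R) :
  measurable_fun setT f -> (forall x, 0 <= f x) ->
  \int[iid_law F n.+1]_x f x =
  \int[F]_a \int[iid_law F n]_x f (tcons (a, x)).
Proof.
move=> mf f0 /=; rewrite ge0_integral_distribution//.
rewrite fubini_tonelli1//; last by move=> x; exact: f0.
by apply: measurableT_comp => //; exact: measurable_tcons.
Qed.

Local Opaque iid_law.

Lemma integral_iid_law_tnth n (i : 'I_n) (f : T -> \bar R) :
  measurable_fun setT f -> (forall x, 0 <= f x) ->
  \int[iid_law F n]_x f (tnth x i) = \int[F]_a f a.
Proof.
move=> mf f0; elim: n i => [[]//|n IH] i.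
rewrite integral_iid_lawS//; last exact: measurableT_comp (measurable_tnth i).
case: (unliftP ord0 i) => [j|] ->.
  under eq_integral => a _ do
    (under eq_integral do rewrite /tcons tnthS/=; rewrite IH).
  by rewrite integral_cst//= probability_setT mule1.
under eq_integral => a _ do
  (under eq_integral do rewrite /tcons tnth0/=;
   rewrite integral_cst//= probability_setT mule1).
by [].
Qed.

Definition splice n (J : pred 'I_n) (x y : n.-tuple T) : n.-tuple T :=
  [tuple if J i then tnth y i else tnth x i | i < n].

Lemma measurable_splice n J d1 (X : measurableType d1) (f g : X -> n.-tuple T) :
  measurable_fun setT f -> measurable_fun setT g ->
  measurable_fun setT (fun x => splice J (f x) (g x)).
Proof.
move=> mf mg; apply/measurable_fun_tnthP => i.
rewrite (_ : _ \o _ = fun x => if J i then tnth (g x) i else tnth (f x) i).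
  by case: (J i); exact: measurable_tuple_comp.
by apply/funext => x /=; rewrite tnth_mktuple.
Qed.

Lemma splice_tcons n (J : pred 'I_n.+1) a b (x y : n.-tuple T) :
  splice J (tcons (a, x)) (tcons (b, y)) =
  tcons (if J ord0 then b else a, splice (fun i => J (lift ord0 i)) x y).
Proof.
apply: eq_from_tnth => i; rewrite tnth_mktuple.
case: (unliftP ord0 i) => [j|] -> /=; first by rewrite !tnthS tnth_mktuple.
by rewrite !tnth0.
Qed.

(** Independent coordinates may be redrawn from an independent copy without changing the law.
    Independence and conditioning are both derived from this, so a tuple never has to be cut into a
    product of two blocks. *)
Lemma integral_splice n (J : pred 'I_n) (f : n.-tuple T -> \bar R) :
  measurable_fun setT f -> (forall x, 0 <= f x) ->
  \int[iid_law F n]_x \int[iid_law F n]_y f (splice J x y) =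
  \int[iid_law F n]_x f x.
Proof.
elim: n J f => [|n IH] J f mf f0.
  under eq_integral => x _ do
    (under eq_integral do rewrite [splice _ _ _]tuple0 -[[tuple]](tuple0 x);
     rewrite integral_cst//= probability_setT mule1).
  by [].
pose J' : pred 'I_n := fun i => J (lift ord0 i).
have mfc c : measurable_fun setT (fun z => f (tcons (c, z))).
  by apply: measurableT_comp => //; apply: (measurableT_comp (@measurable_tcons _ _ _)).
have -> : \int[iid_law F n.+1]_x f x =
    \int[F]_c \int[iid_law F n]_x \int[iid_law F n]_y f (tcons (c, splice J' x y)).
  rewrite (integral_iid_lawS mf f0); apply: eq_integral => c _.
  by rewrite -(IH J' (fun z => f (tcons (c, z)))).
have mF : measurable_fun setT
   (fun z => f (splice J z.1 z.2) : \bar R).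
  by apply: measurableT_comp => //; exact: measurable_splice.
have mFF := measurable_fun_fubini_tonelli_F (m2 := iid_law F n.+1) _ mF (fun=> f0 _).
rewrite (integral_iid_lawS mFF); last by move=> x; apply: integral_ge0.
transitivity (\int[F]_a \int[iid_law F n]_x \int[F]_b \int[iid_law F n]_y
    f (tcons (if J ord0 then b else a, splice J' x y))).
  apply: eq_integral => a _; apply: eq_integral => x _.
  have mfs : measurable_fun setT (fun y => f (splice J (tcons (a, x)) y)).
    by apply: measurableT_comp => //; apply: measurable_splice.
  rewrite /fubini_F/= (integral_iid_lawS mfs); last by move=> y; exact: f0.
  by apply: eq_integral => b _; apply: eq_integral => y _; rewrite splice_tcons.
(* Exchanging the tail [x] with the head [b] puts the integrals over [a] and [b] side by side; the
   one that [J] discards is then the integral of a constant. *)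
under eq_integral => a _.
  rewrite (fubini_tonelli
    (fun z => \int[iid_law F n]_y
       f (tcons (if J ord0 then z.2 else a, splice J' z.1 y)))); last 2 first.
  - apply: (measurable_fun_fubini_tonelli_F
      (fun w => f (tcons (if J ord0 then w.1.2 else a, splice J' w.1.1 w.2)))) => //.
    apply: measurableT_comp => //; apply: measurableT_comp; first exact: measurable_tcons.
    apply/measurable_fun_pairP; split.
      have [_|_] := boolP (J ord0); last exact: measurable_cst.
      by apply: (measurableT_comp measurable_snd); exact: measurable_fst.
    by apply: measurable_splice => //; exact: measurableT_comp.
  - by move=> z; apply: integral_ge0.
  over.
case: (J ord0) => /=.
  by rewrite integral_cst//= probability_setT mule1.
apply: eq_integral => a _.
by rewrite integral_cst//= probability_setT mule1.
Qed.

Definition depends_on n (J : pred 'I_n) S (f : n.-tuple T -> S) :=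
  forall x y, (forall i, J i -> tnth x i = tnth y i) -> f x = f y.

Lemma depends_on_splicel n (J : pred 'I_n) S (f : n.-tuple T -> S) x y :
  depends_on (predC J) f -> f (splice J x y) = f x.
Proof. by apply => i /= /negbTE Ji; rewrite tnth_mktuple Ji. Qed.

Lemma depends_on_splicer n (J : pred 'I_n) S (f : n.-tuple T -> S) x y :
  depends_on J f -> f (splice J x y) = f y.
Proof. by apply => i Ji; rewrite tnth_mktuple Ji. Qed.

(** After redrawing the coordinates in [J], [u] sees only the old draw and [v] only the new one. *)
Lemma integral_indep n (J : pred 'I_n) (u v : n.-tuple T -> \bar R) :
  measurable_fun setT u -> (forall x, 0 <= u x) -> depends_on (predC J) u ->
  measurable_fun setT v -> (forall x, 0 <= v x) -> depends_on J v ->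
  \int[iid_law F n]_x (u x * v x) =
  (\int[iid_law F n]_x u x) * (\int[iid_law F n]_x v x).
Proof.
move=> mu u0 Ju mv v0 Jv; rewrite -(integral_splice J); last 2 first.
- exact: emeasurable_funM.
- by move=> x; exact: mule_ge0.
under eq_integral => x _.
  under eq_integral => y _ do
    rewrite depends_on_splicel// depends_on_splicer//.
  rewrite ge0_integralZl//; over.
by rewrite ge0_integralZr//; apply: integral_ge0.
Qed.

(** The inner integral is the conditional expectation of [h] given the coordinates outside [J], on
    which [g] depends. *)
Lemma integral_elim n (J : pred 'I_n) (g h : n.-tuple T -> \bar R) :
  measurable_fun setT g -> (forall x, 0 <= g x) -> depends_on (predC J) g ->
  measurable_fun setT h -> (forall x, 0 <= h x) ->
  \int[iid_law F n]_x (g x * h x) =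
  \int[iid_law F n]_x (g x * \int[iid_law F n]_y h (splice J x y)).
Proof.
move=> mg g0 Jg mh h0; rewrite -(integral_splice J); last 2 first.
- exact: emeasurable_funM.
- by move=> x; exact: mule_ge0.
apply: eq_integral => x _.
under eq_integral => y _ do rewrite depends_on_splicel//.
rewrite ge0_integralZl//.
by apply: measurableT_comp => //; exact: measurable_splice.
Qed.

End iid_integral.

Section densities.
Context d (T : measurableType d) (R : realType).
Local Open Scope ereal_scope.

(** Stated for nonnegative functions rather than for sets, so that it applies directly to the inner
    integrals of an iterated integral. *)
Definition has_density (F G : probability T R) (f : T -> R) :=
  [/\ measurable_fun setT f, (forall x, 0 <= f x)%R &
    forall g : T -> \bar R, measurable_fun setT g -> (forall x, 0 <= g x) ->
    \int[F]_x g x = \int[G]_x (g x * (f x)%:E)].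

End densities.

Local Opaque iid_law.

Section iid_densities.
Context d (T : measurableType d) (R : realType).
Local Open Scope ereal_scope.

Lemma measurable_prod_tnth n (f : T -> R) : measurable_fun setT f ->
  measurable_fun setT (fun x : n.-tuple T => \prod_(i < n) f (tnth x i))%R.
Proof.
move=> mf; apply: measurable_prod => i _.
by apply: measurableT_comp => //; exact: measurable_tnth.
Qed.

Lemma prod_tnth_tcons n (f : T -> R) a (x : n.-tuple T) :
  (\prod_(i < n.+1) f (tnth (tcons (a, x)) i) =
   f a * \prod_(i < n) f (tnth x i))%R.
Proof.
rewrite big_ord_recl tnth0; congr (_ * _)%R.
by apply: eq_bigr => i _; rewrite tnthS.
Qed.

Lemma integral_iid_law_prod (G : probability T R) n (f : T -> R) c :
  measurable_fun setT f -> (forall x, 0 <= f x)%R ->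
  \int[G]_x (f x)%:E = c%:E ->
  \int[iid_law G n]_x (\prod_(i < n) f (tnth x i))%:E = (c ^+ n)%:E.
Proof.
move=> mf f0 fc; elim: n => [|n IH].
  under eq_integral do rewrite big_ord0.
  by rewrite integral_cst//= probability_setT mule1.
rewrite integral_iid_lawS; last 2 first.
- by apply/measurable_EFinP; exact: measurable_prod_tnth.
- by move=> x; rewrite lee_fin prodr_ge0.
under eq_integral => a _.
  under eq_integral => x _ do rewrite prod_tnth_tcons EFinM.
  rewrite ge0_integralZl ?lee_fin//; last 2 first.
    by apply/measurable_EFinP; exact: measurable_prod_tnth.
    by move=> x _; rewrite lee_fin prodr_ge0.
  rewrite IH; over.
rewrite ge0_integralZr ?fc//.
- by rewrite exprS EFinM.
- exact/measurable_EFinP.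
- by move=> x _; rewrite lee_fin.
- by rewrite lee_fin exprn_ge0// -lee_fin -fc integral_ge0// => x _; rewrite lee_fin.
Qed.

Lemma has_density_iid_law (F G : probability T R) (f : T -> R) n :
  has_density F G f ->
  has_density (iid_law F n) (iid_law G n)
    (fun x => \prod_(i < n) f (tnth x i))%R.
Proof.
move=> [mf f0 fd]; split; first exact: measurable_prod_tnth.
  by move=> x; exact: prodr_ge0.
elim: n => [|n IH] g mg g0.
  by under [RHS]eq_integral do rewrite big_ord0 mule1.
have mgc a : measurable_fun setT (fun x => g (tcons (a, x))).
  by apply: measurableT_comp => //; apply: (measurableT_comp (@measurable_tcons _ _ _)).
rewrite !integral_iid_lawS//; last 2 first.
- by apply: emeasurable_funM => //; apply/measurable_EFinP; exact: measurable_prod_tnth.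
- by move=> x; rewrite mule_ge0// lee_fin prodr_ge0.
rewrite fd; last 2 first.
- apply: (measurable_fun_fubini_tonelli_F (fun z => g (tcons z))) => //.
  by apply: measurableT_comp => //; exact: measurable_tcons.
- by move=> x; exact: integral_ge0.
apply: eq_integral => a _.
rewrite IH// -ge0_integralZr ?lee_fin//; last 2 first.
- by apply: emeasurable_funM => //; apply/measurable_EFinP; exact: measurable_prod_tnth.
- by move=> x _; rewrite mule_ge0// lee_fin prodr_ge0.
apply: eq_integral => x _.
by rewrite prod_tnth_tcons EFinM -!muleA [in RHS](muleC (f a)%:E).
Qed.

End iid_densities.

(** * Gaussian integrals *)

Section measure_with_density.
Context d (T : measurableType d) (R : realType).
Local Open Scope ereal_scope.

Import HBNNSimple.

(** Both sides commute with monotone limits, so it suffices to compare them on simple functions,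
    where the hypothesis on sets applies to each level set. *)
Lemma ge0_integral_density (nu mu : {measure set T -> \bar R}) (f : T -> R)
    (g : T -> \bar R) :
  measurable_fun setT f -> (forall x, 0 <= f x)%R ->
  (forall A, measurable A -> nu A = \int[mu]_(x in A) (f x)%:E) ->
  measurable_fun setT g -> (forall x, 0 <= g x) ->
  \int[nu]_x g x = \int[mu]_x (g x * (f x)%:E).
Proof.
move=> mf f0 nuf mg g0.
pose h := nnsfun_approx measurableT mg.
have hg x : (h n x)%:E @[n --> \oo] --> g x.
  exact: (cvg_nnsfun_approx measurableT mg (fun y _ => g0 y) (x := x) Logic.I).
have hnd x : {homo (fun n => h n x) : m n / (m <= n)%N >-> (m <= n)%R}.
  by move=> m n mn; exact/lefP/nd_nnsfun_approx.
have -> : \int[nu]_x g x = limn (fun n => \int[nu]_x (h n x)%:E).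
  rewrite -monotone_convergence//.
  - by apply: eq_integral => x _; apply/esym/cvg_lim => //; exact: hg.
  - by move=> n; apply/measurable_EFinP.
  - by move=> n x _; rewrite lee_fin.
  - by move=> x _ m n mn; rewrite lee_fin; exact: hnd.
have -> : \int[mu]_x (g x * (f x)%:E) =
    limn (fun n => \int[mu]_x ((h n x)%:E * (f x)%:E)).
  rewrite -monotone_convergence//.
  - apply: eq_integral => x _; apply/esym/cvg_lim => //.
    by apply: cvgeZr => //; exact: hg.
  - by move=> n; apply: emeasurable_funM; apply/measurable_EFinP.
  - by move=> n x _; rewrite mule_ge0// lee_fin.
  - by move=> x _ m n mn; rewrite lee_wpmul2r ?lee_fin//; exact: hnd.
congr (limn _); apply/funext => n.
under eq_integral do rewrite fimfunE -fsumEFin//.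
rewrite ge0_integral_fsum//; last 2 first.
- by move=> r; exact/measurable_EFinP/measurable_funM.
- by move=> m x _; exact: nnfun_muleindic_ge0.
under [RHS]eq_integral => x _.
  rewrite fimfunE -fsumEFin// ge0_mule_fsuml; last first.
    by move=> y; exact: nnfun_muleindic_ge0.
  over.
rewrite ge0_integral_fsum//; last 2 first.
- move=> r; apply: emeasurable_funM; apply/measurable_EFinP => //.
  exact: measurable_funM.
- by move=> m x _; rewrite mule_ge0 ?lee_fin// -lee_fin nnfun_muleindic_ge0.
apply: eq_fsbigr => r rhn.
rewrite integralZl_indic_nnsfun// integral_indic// setIT nuf//.
under [RHS]eq_integral do rewrite EFinM -muleA.
rewrite ge0_integralZl//.
- congr (_ * _); rewrite integral_mkcond; apply: eq_integral => x _.
  by rewrite epatch_indic muleC.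
- by apply: emeasurable_funM; apply/measurable_EFinP.
- by move=> x _; rewrite mule_ge0// lee_fin.
- by move: rhn => /set_mem[x _ <-]; rewrite lee_fin.
Qed.

End measure_with_density.

Section lebesgue_affine.
Context (R : realType).
Local Open Scope ereal_scope.
Notation mu := (@lebesgue_measure R).

(** The rescaled pushforward gives every half-open interval its length, hence it is Lebesgue measure
    by uniqueness. *)
Lemma lebesgue_measure_affine (s b : R) (A : set (measurableTypeR R)) :
  (0 < s)%R -> measurable A -> mu A = s%:E * mu ((fun x => s * x + b)%R @^-1` A).
Proof.
move=> s0 mA; pose phi : measurableTypeR R -> measurableTypeR R :=
  fun x => (s * x + b)%R.
have mphi : measurable_fun setT phi by apply: measurable_funD => //; exact: measurable_funM.
pose nu : {measure set (measurableTypeR R) -> \bar R} :=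
  mscale (NngNum (ltW s0)) (pushforward mu phi).
rewrite (@lebesgue_measure_unique _ (nu mphi) _ A)// => X [[x y] _ <-].
transitivity (s%:E * mu (phi @^-1` `]x, y])); last by [].
have -> : phi @^-1` `]x, y] = `]((x - b) / s)%R, ((y - b) / s)%R]%classic.
  apply/seteqP; split=> z /=; rewrite !in_itv/= /phi ltr_pdivrMr// ler_pdivlMr//;
    by rewrite ltrBlDr lerBrDr (mulrC z).
rewrite !lebesgue_measure_itv/= !lte_fin ltr_pM2r ?invr_gt0// ltrD2r.
case: ifPn => _; last by rewrite mule0.
rewrite -!EFinD -EFinM; congr EFin.
by field; rewrite gt_eqF.
Qed.

Lemma integral_lebesgue_affine (s b : R) (f : R -> \bar R) : (0 < s)%R ->
  measurable_fun setT f -> (forall x, 0 <= f x) ->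
  \int[mu]_x f x = \int[mu]_x (s%:E * f (s * x + b)%R).
Proof.
move=> s0 mf f0; pose phi : measurableTypeR R -> measurableTypeR R :=
  fun x => (s * x + b)%R.
have mphi : measurable_fun setT phi by apply: measurable_funD => //; exact: measurable_funM.
pose nu : {measure set (measurableTypeR R) -> \bar R} :=
  mscale (NngNum (ltW s0)) (pushforward mu phi).
transitivity (\int[nu mphi]_x f x).
  by apply: eq_measure_integral => A mA _; exact: lebesgue_measure_affine.
rewrite ge0_integral_mscale// ge0_integral_pushforward// preimage_setT.
rewrite -ge0_integralZl//; last by move=> x _; exact: f0.
exact: (measurableT_comp (mf : measurable_fun setT (f : measurableTypeR R -> _)) mphi).
Qed.

End lebesgue_affine.

Section std_normal_integral.
Context (R : realType).
Local Open Scope ereal_scope.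
Notation mu := (@lebesgue_measure R).
Notation phi := (std_normal R).

Lemma normal_pdf01 (x : R) :
  (normal_pdf 0 1 x = normal_peak 1 * expR (- (x ^+ 2 / 2)))%R.
Proof. by rewrite normal_pdfE ?oner_neq0// /normal_fun subr0 expr1n mulNr. Qed.

Lemma integral_std_normal (f : R -> \bar R) :
  measurable_fun setT f -> (forall x, 0 <= f x) ->
  \int[phi]_x f x = \int[mu]_x (f x * (normal_pdf 0 1 x)%:E).
Proof.
move=> mf f0; rewrite ge0_integral_distribution//.
apply: (@ge0_integral_density _ (measurableTypeR R) R (normal_prob 0 1) mu) => //.
- exact: measurable_normal_pdf.
- exact: normal_pdf_ge0.
Qed.

(** The Jacobian [s] times the ratio of the standard normal density at [s * x + b] to its value at
    [x]. *)
Definition normal_weight s b (x : R) : R :=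
  s * expR (x ^+ 2 / 2 - (s * x + b) ^+ 2 / 2).

Lemma measurable_normal_weight s b : measurable_fun setT (normal_weight s b).
Proof.
apply: measurable_funM => //; apply: measurableT_comp => //.
apply: measurable_funB; apply: measurable_funM => //; apply: measurable_funX => //.
by apply: measurable_funD => //; exact: measurable_funM.
Qed.

Lemma integral_std_normal_affine (s b : R) (f : R -> \bar R) : (0 < s)%R ->
  measurable_fun setT f -> (forall x, 0 <= f x) ->
  \int[phi]_x f x = \int[phi]_x (f (s * x + b)%R * (normal_weight s b x)%:E).
Proof.
move=> s0 mf f0.
have mfs : measurable_fun setT (fun x : R => f (s * x + b)%R).
  by apply: (measurableT_comp mf); apply: measurable_funD => //; exact: measurable_funM.
rewrite !integral_std_normal//; last 2 first.
- apply: emeasurable_funM => //; apply/measurable_EFinP.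
  exact: measurable_normal_weight.
- by move=> x; rewrite mule_ge0// lee_fin mulr_ge0 ?expR_ge0 ?ltW.
rewrite (integral_lebesgue_affine b s0); last 2 first.
- apply: emeasurable_funM => //; apply/measurable_EFinP.
  exact: measurable_normal_pdf.
- by move=> x; rewrite mule_ge0// lee_fin normal_pdf_ge0.
apply: eq_integral => x _.
rewrite muleCA -[in RHS]muleA -!EFinM; congr (_ * _%:E).
rewrite !normal_pdf01 /normal_weight -[in RHS]mulrA (mulrCA (expR _)) -expRD.
by congr (_ * (_ * expR _))%R; field.
Qed.

(** Completing the square: the substitution of scale [s] and shift [b * s ^+ 2] makes the exponent
    constant, since [s ^+ 2] is the inverse of [1 - a *+ 2]. *)
Lemma integral_std_normal_gauss (a b s : R) : (0 < s)%R ->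
  (s ^+ 2 * (1 - a *+ 2) = 1)%R ->
  \int[phi]_x (expR (a * x ^+ 2 + b * x))%:E =
  (s * expR (b ^+ 2 * s ^+ 2 / 2))%:E.
Proof.
move=> s0 sa.
rewrite (@integral_std_normal_affine s (b * s ^+ 2))//; last first.
  apply/measurable_EFinP; apply: measurableT_comp => //.
  by apply: measurable_funD; apply: measurable_funM => //; exact: measurable_funX.
under eq_integral => x _.
  rewrite -EFinM /normal_weight mulrCA -expRD.
  rewrite [X in expR X](_ : _ = b ^+ 2 * s ^+ 2 / 2)%R; last first.
    apply/eqP; rewrite -subr_eq0; apply/eqP.
    transitivity (- (x + b * s) ^+ 2 / 2 * (s ^+ 2 * (1 - a *+ 2) - 1))%R.
      by field.
    by rewrite sa subrr mulr0.
  over.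
by rewrite integral_cst//= probability_setT mule1.
Qed.

End std_normal_integral.

Section pair_ratio.
Context (R : realType).
Local Open Scope ereal_scope.
Notation phi := (std_normal R).

(* Density, with respect to the law of two independent standard normal
   variables, of a normal pair with unit variances and covariance [d], where
   [d ^+ 2 + s ^+ 2 = 1]. *)
Definition pair_ratio (d s x y : R) : R :=
  s^-1 * expR ((2 * d * x * y - d ^+ 2 * (x ^+ 2 + y ^+ 2)) / (2 * s ^+ 2)).

Lemma pair_ratioC d s x y : pair_ratio d s x y = pair_ratio d s y x.
Proof.
by rewrite /pair_ratio (addrC (x ^+ 2)%R) -(mulrA _ x y) (mulrC x) mulrA.
Qed.

Lemma measurable_pair_ratio d1 (X : measurableType d1) (d s : R) (f g : X -> R) :
  measurable_fun setT f -> measurable_fun setT g ->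
  measurable_fun setT (fun x => pair_ratio d s (f x) (g x)).
Proof.
move=> mf mg; apply: measurable_funM => //; apply: measurableT_comp => //.
apply: measurable_funM => //; apply: measurable_funB.
  by apply: measurable_funM => //; exact: measurable_funM.
apply: measurable_funM => //.
by apply: measurable_funD; exact: measurable_funX.
Qed.

Context (d s : R) (s0 : (0 < s)%R) (ds : (d ^+ 2 + s ^+ 2 = 1)%R).

Lemma pair_ratio_ge0 x y : (0 <= pair_ratio d s x y)%R.
Proof. by rewrite mulr_ge0 ?expR_ge0 ?invr_ge0 ?ltW. Qed.

(** Given that the first coordinate is [a], the second has law N(d a, s^2), and [pair_ratio d s a]
    is its density relative to [phi]. After the substitution the two exponents cancel because of
    [ds]. *)
Lemma integral_pair_ratio (a : R) (h : R -> \bar R) :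
  measurable_fun setT h -> (forall x, 0 <= h x) ->
  \int[phi]_y h (d * a + s * y)%R = \int[phi]_y (h y * (pair_ratio d s a y)%:E).
Proof.
move=> mh h0; rewrite [RHS](integral_std_normal_affine (d * a) s0); last 2 first.
- by apply: emeasurable_funM => //; apply/measurable_EFinP; exact: measurable_pair_ratio.
- by move=> x; rewrite mule_ge0// lee_fin pair_ratio_ge0.
apply: eq_integral => y _; rewrite addrC -muleA -EFinM.
rewrite [X in _ * X%:E](_ : _ = 1)%R ?mule1//.
rewrite /pair_ratio /normal_weight mulrACA mulVf ?gt_eqF// mul1r -expRD.
rewrite -[RHS]expR0; congr expR; apply/eqP.
rewrite [X in X == _](_ : _ = (1 - (d ^+ 2 + s ^+ 2)) * (s * y + d * a) ^+ 2
   / (2 * s ^+ 2))%R; first by rewrite ds subrr !mul0r.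
by field; rewrite gt_eqF.
Qed.

Lemma integral_pair_ratio1 (a : R) : \int[phi]_y (pair_ratio d s a y)%:E = 1.
Proof.
have := @integral_pair_ratio a (cst 1) (measurable_cst _) (fun=> lee01).
rewrite integral_cst//= probability_setT mule1 => ->.
by apply: eq_integral => y _; rewrite mul1e.
Qed.

Lemma integral_pair_ratio_sqr :
  \int[phi]_x \int[phi]_y (pair_ratio d s x y ^+ 2)%:E = (s ^- 2)%:E.
Proof.
(* The scales of the inner and of the outer Gaussian integral are [s / t] and [t / s]; the factors
   [t] cancel and [s ^- 2] remains. *)
pose t := Num.sqrt (1 + d ^+ 2).
have t2 : (t ^+ 2 = 1 + d ^+ 2)%R by rewrite sqr_sqrtr// addr_ge0 ?sqr_ge0.
have t0 : (0 < t)%R by rewrite sqrtr_gt0 ltr_wpDr ?sqr_ge0.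
have s2 : (s ^+ 2 = 1 - d ^+ 2)%R by rewrite -ds addrC addKr.
have s2n : (1 - d ^+ 2 != 0)%R by rewrite -s2 expf_neq0// gt_eqF.
have t2n : (1 + d ^+ 2 != 0)%R by rewrite -t2 expf_neq0// gt_eqF.
have inner x : \int[phi]_y (pair_ratio d s x y ^+ 2)%:E =
    ((s * t)^-1 * expR (d ^+ 2 / t ^+ 2 * x ^+ 2 + 0 * x))%:E.
  under eq_integral => y _.
    rewrite /pair_ratio exprMn -expRM_natl.
    rewrite [X in expR X](_ : _ = - (d ^+ 2 / s ^+ 2) * x ^+ 2 +
      (- (d ^+ 2 / s ^+ 2) * y ^+ 2 + (2 * d * x / s ^+ 2) * y))%R; last first.
      by field; rewrite gt_eqF.
    rewrite expRD mulrA EFinM; over.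
  rewrite ge0_integralZl//; last 2 first.
  - apply/measurable_EFinP; apply: measurableT_comp => //.
    by apply: measurable_funD; apply: measurable_funM => //; exact: measurable_funX.
  - by rewrite lee_fin mulr_ge0 ?expR_ge0// exprn_ge0// invr_ge0 ltW.
  rewrite (@integral_std_normal_gauss _ _ _ (s / t)) ?divr_gt0//; last first.
    by rewrite expr_div_n s2 t2; field; rewrite s2n t2n.
  rewrite -EFinM; congr EFin.
  rewrite mulrACA -expRD; congr (_ * expR _)%R.
    by field; rewrite !gt_eqF.
  by rewrite !expr_div_n mul0r addr0 s2 t2; field; rewrite s2n t2n.
under eq_integral do rewrite inner EFinM.
rewrite ge0_integralZl//; last 2 first.
- apply/measurable_EFinP; apply: measurableT_comp => //.
  by apply: measurable_funD; apply: measurable_funM => //; exact: measurable_funX.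
- by rewrite lee_fin invr_ge0 mulr_ge0// ltW.
rewrite (@integral_std_normal_gauss _ _ _ (t / s)) ?divr_gt0//; last first.
  by rewrite expr_div_n s2 t2; field; rewrite s2n t2n.
rewrite expr0n/= !mul0r expR0 mulr1 -EFinM; congr EFin.
by field; rewrite !gt_eqF.
Qed.

End pair_ratio.

(** * Moments *)

Section has_mean.
Context d (T : measurableType d) (R : realType).
Implicit Types (P : probability T R) (f g : T -> R).

(** Integrability is bundled with the value, so that means add and scale without side conditions. *)
Definition has_mean P f (c : R) :=
  P.-integrable setT (EFin \o f) /\ (\int[P]_x (f x)%:E = c%:E)%E.

Lemma has_mean_measurable P f c : has_mean P f c -> measurable_fun setT f.
Proof. by move=> [/measurable_int/measurable_EFinP]. Qed.

Lemma has_mean_unique P f c c' : has_mean P f c -> has_mean P f c' -> c = c'.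
Proof. by move=> [_ fc] [_]; rewrite fc => -[]. Qed.

Lemma eq_has_mean P f g c : f =1 g -> has_mean P f c -> has_mean P g c.
Proof. by move=> /funext <-. Qed.

Lemma has_mean_cst P c : has_mean P (cst c) c.
Proof.
split; last by rewrite -[RHS]mule1 -(probability_setT P); exact: (integral_cst P measurableT c%:E).
exact: finite_measure_integrable_cst.
Qed.

Lemma has_meanD P f g a b : has_mean P f a -> has_mean P g b ->
  has_mean P (fun x => f x + g x) (a + b).
Proof.
move=> [fi fa] [gi gb]; split; first exact: integrableD fi gi.
by have := integralD_EFin measurableT fi gi; rewrite /= fa gb.
Qed.

Lemma has_meanZ P k f a : has_mean P f a -> has_mean P (fun x => k * f x) (k * a).
Proof.
move=> [fi fa]; split; first exact: (integrableZl measurableT k fi).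
by under eq_integral do rewrite EFinM; rewrite (integralZl measurableT fi) fa.
Qed.

Lemma has_meanB P f g a b : has_mean P f a -> has_mean P g b ->
  has_mean P (fun x => f x - g x) (a - b).
Proof.
move=> fa gb; have := has_meanD fa (has_meanZ (-1) gb).
by rewrite mulN1r; apply: eq_has_mean => x; rewrite mulN1r.
Qed.

Lemma has_mean_sum P (I : Type) (r : seq I) (F : I -> T -> R) (c : I -> R) :
  (forall i, has_mean P (F i) (c i)) ->
  has_mean P (fun x => \sum_(i <- r) F i x) (\sum_(i <- r) c i).
Proof.
move=> Fc; elim: r => [|i r IH].
  rewrite big_nil; apply: eq_has_mean (has_mean_cst P 0) => x.
  by rewrite big_nil.
rewrite big_cons; apply: eq_has_mean (has_meanD (Fc i) IH) => x.
by rewrite big_cons.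
Qed.

Lemma has_mean_expectation P f c : has_mean P f c -> ('E_P[f] = c%:E)%E.
Proof. by move=> [_ fc]; rewrite unlock. Qed.

Lemma has_mean_covariance P f g a b c : has_mean P f a -> has_mean P g b ->
  has_mean P (fun x => (f x - a) * (g x - b)) c -> covariance P f g = c%:E.
Proof.
move=> fa gb; rewrite covariance.unlock (has_mean_expectation fa) (has_mean_expectation gb).
exact: has_mean_expectation.
Qed.

End has_mean.

Lemma has_mean_distribution d d' (T : measurableType d) (T' : measurableType d')
    (R : realType) (P : probability T R) (X : {mfun T >-> T'}) (f : T' -> R) c :
  measurable_fun setT f -> has_mean P (fun x => f (X x)) c ->
  has_mean (distribution P X) f c.
Proof.
move=> mf [fi fc]; have mf' : measurable_fun setT (EFin \o f) by apply/measurable_EFinP.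
by split; [exact: integrable_pushforward|rewrite (integral_distribution mf' fi)].
Qed.

Lemma has_mean_prod d d' (T : measurableType d) (T' : measurableType d')
    (R : realType) (P : probability T R) (Q : probability T' R) (f : T -> R)
    (g : T' -> R) a b :
  has_mean P f a -> has_mean Q g b ->
  has_mean (P \x Q)%E (fun z => f z.1 * g z.2) (a * b).
Proof.
move=> fa gb; have mf := has_mean_measurable fa; have mg := has_mean_measurable gb.
have mfg : measurable_fun setT (fun z : T * T' => f z.1 * g z.2).
  by apply: measurable_funM; exact: measurableT_comp.
have mfg' : measurable_fun setT (EFin \o (fun z : T * T' => f z.1 * g z.2)).
  exact/measurable_EFinP.
have i : (P \x Q)%E.-integrable setT (EFin \o (fun z => f z.1 * g z.2)).
  apply/integrable12ltyP => //.
  under eq_integral => x _.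
    under eq_integral do rewrite /= normrM EFinM.
    rewrite ge0_integralZl//; last first.
      by do 2 apply: measurableT_comp => //.
    over.
  rewrite ge0_integralZr//; last 2 first.
  - by do 2 apply: measurableT_comp => //.
  - by apply: integral_ge0.
  have [/integrableP[_ fi] _] := fa; have [/integrableP[_ gi] _] := gb.
  by apply: lte_mul_pinfty => //; [exact: integral_ge0|rewrite ge0_fin_numE//; exact: integral_ge0].
split => //; rewrite -(integral12_prod_meas1 i) /fubini_F/=.
rewrite mulrC; have [_ <-] := has_meanZ b fa; apply: eq_integral => x _.
by have [_] := has_meanZ (f x) gb; rewrite mulrC.
Qed.

Lemma has_mean_iid_law_prod d (T : measurableType d) (R : realType)
    (P : probability T R) n (f : 'I_n -> T -> R) (c : 'I_n -> R) :
  (forall i, has_mean P (f i) (c i)) ->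
  has_mean (iid_law P n) (fun x => \prod_i f i (tnth x i)) (\prod_i c i).
Proof.
elim: n f c => [|n IH] f c fc.
  rewrite big_ord0; apply: eq_has_mean (has_mean_cst _ 1) => x.
  by rewrite big_ord0.
have mprod : measurable_fun setT (fun x : n.+1.-tuple T => \prod_i f i (tnth x i)).
  apply: measurable_prod => i _.
  exact: measurableT_comp (has_mean_measurable (fc i)) (measurable_tnth i).
rewrite big_ord_recl /=; apply: has_mean_distribution => //.
have := has_mean_prod (fc ord0) (IH _ _ (fun i => fc (lift ord0 i))).
apply: eq_has_mean => -[a x] /=; rewrite big_ord_recl tnth0; congr (_ * _).
by apply: eq_bigr => i _; rewrite tnthS.
Qed.

Section std_normal_moments.
Context (R : realType).
Notation phi := (std_normal R).

(** Once the inner law is written with [pair_ratio], the symmetry of that density lets [x] be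
    integrated out first, with total mass 1. *)
Lemma integral_std_normal_rotation (d s : R) (h : R -> \bar R) :
  0 < s -> d ^+ 2 + s ^+ 2 = 1 ->
  measurable_fun setT h -> (forall x, 0 <= h x)%E ->
  (\int[phi]_x \int[phi]_y h (d * x + s * y)%R = \int[phi]_y h y)%E.
Proof.
move=> s0 ds mh h0.
under eq_integral do rewrite (integral_pair_ratio s0 ds)//.
rewrite (fubini_tonelli (fun z => (h z.2 * (pair_ratio d s z.1 z.2)%:E)%E)); last 2 first.
- apply: emeasurable_funM; first exact: measurableT_comp.
  by apply/measurable_EFinP; exact: measurable_pair_ratio.
- by move=> z; rewrite mule_ge0// lee_fin pair_ratio_ge0.
apply: eq_integral => y _ /=; rewrite ge0_integralZl//.
- by under eq_integral do rewrite pair_ratioC; rewrite integral_pair_ratio1// mule1.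
- by apply/measurable_EFinP; exact: measurable_pair_ratio.
- by move=> x _; rewrite lee_fin pair_ratio_ge0.
Qed.

Lemma has_mean_std_normal_rotation (d s : R) (h : R -> R) c :
  0 < s -> d ^+ 2 + s ^+ 2 = 1 -> has_mean phi h c ->
  has_mean (phi \x phi)%E (fun z => h (d * z.1 + s * z.2)) c.
Proof.
move=> s0 ds hc; have mh := has_mean_measurable hc.
have mrot : measurable_fun setT (fun z : R * R => d * z.1 + s * z.2).
  by apply: measurable_funD; exact: measurable_funM.
have mh' : measurable_fun setT (EFin \o h) by apply/measurable_EFinP.
pose rot : {mfun (R * R)%type >-> R} := HB.pack (fun z : R * R => d * z.1 + s * z.2)
  (isMeasurableFun.Build _ _ _ _ _ mrot).
(* Applied to the absolute value of [h] this gives integrability; applied to indicators it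
   identifies the law of [rot] with [phi], which settles signed [h]. *)
have rotE (f : R -> \bar R) : measurable_fun setT f -> (forall x, 0 <= f x)%E ->
    (\int[distribution (phi \x phi)%E rot]_x f x = \int[phi]_x f x)%E.
  move=> mf f0; rewrite ge0_integral_distribution// fubini_tonelli1//.
  - exact: integral_std_normal_rotation.
  - exact: measurableT_comp.
  - by move=> z; exact: f0.
have introt : (phi \x phi)%E.-integrable setT ((EFin \o h) \o rot).
  apply/integrableP; split; first exact: measurableT_comp.
  have [/integrableP[_ hfin] _] := hc.
  rewrite -(rotE (fun x => `|(h x)%:E|%E)) in hfin; last 2 first.
  - exact: measurableT_comp.
  - by [].
  by rewrite ge0_integral_distribution// in hfin; exact: measurableT_comp.
split => //; rewrite -(integral_distribution mh' introt).
have [_ <-] := hc; apply: eq_measure_integral => A mA _.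
have := rotE (fun x => (\1_A x)%:E); rewrite !integral_indic// !setIT; apply.
  by apply/measurable_EFinP; exact: measurable_indic.
by move=> x; rewrite lee_fin.
Qed.

Lemma integrable_std_normal_exprn (k : nat) : (k <= 4)%N ->
  phi.-integrable setT (EFin \o (fun x : R => x ^+ k)).
Proof.
(* Domination: |x|^k <= |x|^4 + 1, where |x|^4 = 64 (x^2/8)^2 <= 64 exp(x^2/4) and 1 <= exp(x^2/4).
   The rate 1/4 stays below the critical 1/2. *)
move=> k4; apply: (@le_integrable _ _ _ phi _ measurableT _
    (fun x : R => (65 * expR (4^-1 * x ^+ 2 + 0 * x))%:E)).
- by apply/measurable_EFinP; exact: measurable_funX.
- move=> x _; rewrite !abse_EFin lee_fin [leRHS]ger0_norm; last first.
    by rewrite mulr_ge0// expR_ge0.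
  rewrite mul0r addr0 normrX.
  have -> : 65 * expR (4^-1 * x ^+ 2) = 64 * expR (8^-1 * x ^+ 2) ^+ 2 +
      expR (4^-1 * x ^+ 2) :> R.
    rewrite -expRM_natl [X in 64 * expR X](_ : _ = 4^-1 * x ^+ 2); last by field.
    by ring.
  apply: (@le_trans _ _ (`|x| ^+ 4 + 1)).
    have [x1|x1] := leP 1 `|x|.
      by rewrite (le_trans (ler_weXn2l _ k4))// lerDl.
    apply: (@le_trans _ _ 1); first by apply: exprn_ile1 => //; exact: ltW.
    by rewrite lerDr exprn_ge0.
  apply: lerD.
    have -> : `|x| ^+ 4 = 64 * (8^-1 * x ^+ 2) ^+ 2.
      by rewrite exprMn -exprM -normrX ger0_norm ?exprn_even_ge0//; field.
    rewrite ler_pM2l// lerXn2r ?nnegrE ?expR_ge0//.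
      by rewrite mulr_ge0 ?sqr_ge0.
    by apply: le_trans (expR_ge1Dx _); rewrite lerDr.
  by rewrite -[leLHS]expR0 ler_expR mulr_ge0 ?sqr_ge0.
- under [X in _.-integrable _ X]eq_fun do rewrite EFinM.
  apply: integrableZl => //; apply/integrableP; split.
    apply/measurable_EFinP; apply: measurableT_comp => //.
    by apply: measurable_funD; apply: measurable_funM => //; exact: measurable_funX.
  under eq_integral do rewrite gee0_abs ?lee_fin ?expR_ge0//.
  rewrite (@integral_std_normal_gauss _ _ _ (Num.sqrt 2)) ?ltry//.
  by rewrite sqr_sqrtr//; field.
Qed.

Let m (k : nat) := fine (\int[phi]_x (x ^+ k)%:E).

Let mE k : (k <= 4)%N -> has_mean phi (fun x => x ^+ k) (m k).
Proof.
move=> k4; split; first exact: integrable_std_normal_exprn.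
by rewrite /m fineK//; apply: integrable_fin_num => //; exact: integrable_std_normal_exprn.
Qed.

Let m0 : m 0 = 1.
Proof. exact: has_mean_unique (mE (leq0n _)) (has_mean_cst phi 1). Qed.

Let mM i j k : (i <= 4)%N -> (j <= 4)%N ->
  has_mean (phi \x phi)%E (fun z : R * R => k * (z.1 ^+ i * z.2 ^+ j)) (k * (m i * m j)).
Proof. by move=> i4 j4; apply: has_meanZ; apply: (has_mean_prod (mE i4) (mE j4)). Qed.

(** Expanding the k-th power of the rotation by (3/5, 4/5) gives a linear equation for [m k] with
    coefficient 1 - (3/5)^k - (4/5)^k. It is nonzero for k = 1, 3, 4 and zero for k = 2, so the
    variance needs an argument of its own. *)
Let rotation_ge0 : (0 : R) < 4 / 5. Proof. by []. Qed.
Let rotation_eq1 : (3 / 5 : R) ^+ 2 + (4 / 5) ^+ 2 = 1. Proof. by field. Qed.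

Let mrot k : (k <= 4)%N ->
  has_mean (phi \x phi)%E (fun z : R * R => (3 / 5 * z.1 + 4 / 5 * z.2) ^+ k) (m k).
Proof.
by move=> k4; exact: (has_mean_std_normal_rotation rotation_ge0 rotation_eq1 (mE k4)).
Qed.

Let m1 : m 1 = 0.
Proof.
have : m 1 = 3 / 5 * (m 1 * m 0) + 4 / 5 * (m 0 * m 1).
  apply: (has_mean_unique (@mrot 1 isT)).
  apply: eq_has_mean (has_meanD (@mM 1 0 (3 / 5) isT isT) (@mM 0 1 (4 / 5) isT isT)) => z.
  by field.
by rewrite m0; lra.
Qed.

Let m2_ge0 : 0 <= m 2.
Proof. by rewrite fine_ge0// integral_ge0// => x _; rewrite lee_fin sqr_ge0. Qed.

(* Taking expectations in [1 + a Z^2 <= exp (a Z^2)] for small [a] of both signs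
   forces [m 2 = 1]; the other moments come from the rotation invariance. *)
Let m2_bound a : a < 1 / 2 -> 0 < 1 + a * m 2 -> (1 + a * m 2) ^+ 2 * (1 - a *+ 2) <= 1.
Proof.
move=> a2 am; have a0 : 0 < 1 - a *+ 2 by lra.
pose s := (Num.sqrt (1 - a *+ 2))^-1.
have s0 : 0 < s by rewrite invr_gt0 sqrtr_gt0.
have s2 : s ^+ 2 * (1 - a *+ 2) = 1.
  by rewrite exprVn sqr_sqrtr ?ltW// mulVf// gt_eqF.
have [i e] := has_meanD (has_mean_cst phi 1) (has_meanZ a (mE (isT : 2 <= 4)%N)).
have mexp : measurable_fun setT (fun x : R => (expR (a * x ^+ 2 + 0 * x))%:E).
  apply/measurable_EFinP; apply: measurableT_comp => //.
  by apply: measurable_funD; apply: measurable_funM => //; exact: measurable_funX.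
have : ((1 + a * m 2)%:E <= s%:E)%E.
  have := integral_std_normal_gauss 0 s0 s2.
  rewrite expr0n/= !mul0r expR0 mulr1 => gauss.
  rewrite -e -gauss; apply: le_integral => //.
  - apply/integrableP; split => //.
    under eq_integral do rewrite gee0_abs ?lee_fin ?expR_ge0//.
    by rewrite gauss ltry.
  - by move=> x _ /=; rewrite lee_fin mul0r addr0 expR_ge1Dx.
rewrite lee_fin => h; rewrite (@le_trans _ _ (s ^+ 2 * (1 - a *+ 2)))//.
  by rewrite ler_pM2r// lerXn2r// nnegrE; exact: ltW.
by rewrite s2.
Qed.

Let m2 : m 2 = 1.
Proof.
apply/eqP; rewrite eq_le; apply/andP; split; rewrite leNgt; apply/negP => m21.
  (* To first order [m2_bound] says 1 + 2 a (m 2 - 1) <= 1, which fails for small [a] of the sign of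
     [m 2 - 1]. This multiple makes the last bracket of the expansion below vanish, and what remains
     is visibly above 1; [- b] does the same when [m 2 < 1]. *)
  pose a : R := (m 2 - 1) / (4 * m 2).
  have ma : a * m 2 = (m 2 - 1) / 4 by rewrite /a; field; lra.
  have a0 : 0 < a by apply: divr_gt0; lra.
  have a4 : a < 1 / 4 by rewrite ltr_pdivrMr; lra.
  have : (1 + a * m 2) ^+ 2 * (1 - a *+ 2) <= 1 by apply: m2_bound; rewrite ?ma; lra.
  apply/negP; rewrite -ltNge.
  rewrite [ltRHS](_ : _ = 1 + 4 * (a * m 2) * a + (a * m 2) ^+ 2 * (1 - 2 * a) +
    2 * (a * m 2 - a * (1 + 4 * (a * m 2)))); last by ring.
  have -> : a * (1 + 4 * (a * m 2)) = a * m 2 by rewrite {1}ma; field.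
  rewrite subrr mulr0 addr0 -addrA ltrDl; apply: ltr_pwDl.
    by rewrite ma; apply: mulr_gt0 => //; lra.
  by rewrite mulr_ge0 ?sqr_ge0//; lra.
pose b : R := (1 - m 2) / 4.
have b0 : 0 < b by rewrite /b; lra.
have mb : 1 - m 2 - 4 * b = 0 by rewrite /b; field.
have : (1 + - b * m 2) ^+ 2 * (1 - (- b) *+ 2) <= 1.
  by apply: m2_bound; [lra|rewrite mulNr subr_gt0; nra].
apply/negP; rewrite -ltNge.
rewrite [ltRHS](_ : _ = 1 + (4 * b ^+ 2 + (4 * b ^+ 2 * (1 - m 2) +
  (b * m 2) ^+ 2 * (1 + 2 * b))) + 2 * b * (1 - m 2 - 4 * b)); last by ring.
rewrite mb mulr0 addr0 ltrDl; apply: ltr_pwDl; first by rewrite mulr_gt0 ?exprn_gt0.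
apply: addr_ge0; apply: mulr_ge0; rewrite ?sqr_ge0//; last by lra.
  by rewrite mulr_ge0 ?sqr_ge0.
by lra.
Qed.

Let m3 : m 3 = 0.
Proof.
have : m 3 = 27 / 125 * (m 3 * m 0) + 108 / 125 * (m 2 * m 1) +
    (144 / 125 * (m 1 * m 2) + 64 / 125 * (m 0 * m 3)).
  apply: (has_mean_unique (@mrot 3 isT)).
  apply: eq_has_mean (has_meanD
    (has_meanD (@mM 3 0 (27 / 125) isT isT) (@mM 2 1 (108 / 125) isT isT))
    (has_meanD (@mM 1 2 (144 / 125) isT isT) (@mM 0 3 (64 / 125) isT isT))) => z.
  by field.
by rewrite m0 m1; lra.
Qed.

Let m4 : m 4 = 3.
Proof.
have : m 4 = 81 / 625 * (m 4 * m 0) + 432 / 625 * (m 3 * m 1) +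
    (864 / 625 * (m 2 * m 2) + 768 / 625 * (m 1 * m 3) + 256 / 625 * (m 0 * m 4)).
  apply: (has_mean_unique (@mrot 4 isT)).
  apply: eq_has_mean (has_meanD
    (has_meanD (@mM 4 0 (81 / 625) isT isT) (@mM 3 1 (432 / 625) isT isT))
    (has_meanD (has_meanD (@mM 2 2 (864 / 625) isT isT) (@mM 1 3 (768 / 625) isT isT))
      (@mM 0 4 (256 / 625) isT isT))) => z.
  by field.
by rewrite m0 m1 m2 m3; lra.
Qed.

Lemma has_mean_std_normal_exprn k : (k <= 4)%N ->
  has_mean phi (fun x => x ^+ k) [:: 1; 0; 1; 0; 3]`_k.
Proof.
move=> k4; have := mE k4.
by case: k k4 => [|[|[|[|[|]]]]]//= _; rewrite ?m0 ?m1 ?m2 ?m3 ?m4.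
Qed.

End std_normal_moments.

Section gaussian_moments.
Context (R : realType) (p : nat).
Notation phi := (std_normal R).
Notation Z := (iid_law phi p).
Implicit Types (a b c d i j l m : 'I_p).

(** The normal moment whose order is the multiplicity of [i] in [s]. Orders above 4 would fall on
    the default 0 of the list; they do not occur in monomials of degree at most 4. *)
Let w (s : seq 'I_p) i : R := [:: 1; 0; 1; 0; 3]`_(count_mem i s).

Lemma has_mean_monomial (s : seq 'I_p) : (size s <= 4)%N ->
  has_mean Z (fun z => \prod_(a <- s) tnth z a) (\prod_i w s i).
Proof.
move=> s4; have := @has_mean_iid_law_prod _ _ _ phi p (fun i x => x ^+ count_mem i s) (w s).
have Mi i : has_mean phi (fun x => x ^+ count_mem i s) (w s i).
  by apply: has_mean_std_normal_exprn; exact: leq_trans (count_size _ _) s4.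
move=> /(_ Mi); apply: eq_has_mean => z /=.
elim: {s4 Mi} s => [|a s IH]; first by rewrite big_nil big1.
rewrite big_cons -IH (bigD1 a)//= eqxx exprS -mulrA; congr (_ * _).
rewrite [RHS](bigD1 a)//=; congr (_ * _); apply: eq_bigr => i ia.
by rewrite eq_sym (negbTE ia).
Qed.

Let prodM_eq0 s i : odd (count_mem i s) -> \prod_i w s i = 0.
Proof.
move=> i1; rewrite (bigD1 i)//= [w _ _](_ : _ = 0) ?mul0r//.
by rewrite /w; case: (count_mem i s) i1 => [|[|[|[|[|k]]]]]//= _; rewrite nth_nil.
Qed.

Let prodM_notin s (P : pred 'I_p) :
  {in s, forall i, ~~ P i} -> \prod_(i | P i) w s i = 1.
Proof.
move=> sP; rewrite big1// => i Pi; rewrite /w (count_memPn _)//.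
by apply/negP => /sP; rewrite Pi.
Qed.

Lemma has_mean_tnth a : has_mean Z (fun z => tnth z a) 0.
Proof.
rewrite -(@prodM_eq0 [:: a] a) ?[count_mem _ _]/= ?eqxx//.
by apply: eq_has_mean (has_mean_monomial _) => // z; rewrite big_seq1.
Qed.

Lemma has_mean_tnth2 a b :
  has_mean Z (fun z => tnth z a * tnth z b) (a == b)%:R.
Proof.
have -> : (a == b)%:R = \prod_i w [:: a; b] i.
  have [<-|ab] := eqVneq a b; last first.
    by rewrite (@prodM_eq0 _ a)//= eqxx eq_sym (negbTE ab).
  rewrite (bigD1 a)//= {1}/w/= eqxx mul1r prodM_notin// => i.
  by rewrite !inE orbb => /eqP ->; rewrite eqxx.
by apply: eq_has_mean (has_mean_monomial _) => // z; rewrite !big_cons big_nil mulr1.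
Qed.

(** Isserlis' formula for independent coordinates. An index of odd multiplicity kills the moment, so
    only pairings count; four equal indices admit all three pairings, in agreement with the fourth
    moment 3. *)
Lemma has_mean_tnth4 a b c d :
  has_mean Z (fun z => tnth z a * (tnth z b * (tnth z c * tnth z d)))
    (((a == b) && (c == d))%:R + ((a == c) && (b == d))%:R +
     ((a == d) && (b == c))%:R).
Proof.
have -> : ((a == b) && (c == d))%:R + ((a == c) && (b == d))%:R +
     ((a == d) && (b == c))%:R = \prod_i w [:: a; b; c; d] i.
  have two x y (s := [:: x; x; y; y]) : x != y -> \prod_i w s i = 1.
    move=> xy; rewrite (bigD1 x)//= {1}/w/= eqxx eq_sym (negbTE xy) mul1r (bigD1 y)//=.
      rewrite {1}/w/= eqxx (negbTE xy) mul1r prodM_notin// => i.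
      by rewrite !inE; case/or4P => /eqP ->; rewrite eqxx ?andbF.
    by rewrite eq_sym.
  have permM s s' : perm_eq s s' ->
      \prod_i w s i = \prod_i w s' i.
    by move=> /seq.permP ss'; apply: eq_bigr => i _; rewrite /w ss'.
  have [<-|ab] := eqVneq a b; have [<-|cd] := eqVneq c d.
  - have [<-|ac] := eqVneq a c; last by rewrite two// !addr0.
    rewrite (bigD1 a)//= {1}/w/= eqxx prodM_notin; last first.
      by move=> i; rewrite !inE !orbb => /eqP ->; rewrite eqxx.
    by rewrite /=; ring.
  - have [ac|ac] := eqVneq a c.
      by rewrite -ac in cd *; rewrite (negbTE cd)/= !addr0 (@prodM_eq0 _ d)//= eqxx (negbTE cd).
    rewrite /= andbF !addr0 (@prodM_eq0 _ c)//=.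
    by rewrite eqxx (negbTE ac) eq_sym (negbTE cd).
  - have [ac|ac] := eqVneq a c.
      rewrite -{}ac (eq_sym b) (negbTE ab)/= !addr0 (@prodM_eq0 _ b)//=.
      by rewrite eqxx (negbTE ab).
    rewrite /= !addr0 (@prodM_eq0 _ a)//=.
    by rewrite eqxx !(eq_sym _ a) (negbTE ab) (negbTE ac).
  - have [ac|ac] := eqVneq a c; have [bd|bd] := eqVneq b d.
    + rewrite -ac -bd ?eqxx (negbTE ab) /= add0r addr0.
      rewrite (permM _ [:: a; a; b; b]) ?two//.
      by apply/seq.permP => P /=; lia.
    + rewrite -{}ac in cd *; rewrite (negbTE cd)/= !addr0 (@prodM_eq0 _ b)//=.
      by rewrite eqxx (negbTE ab) (eq_sym d) (negbTE bd).
    + rewrite -{}bd in cd *; rewrite (negbTE ab)/= !addr0 (@prodM_eq0 _ a)//=.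
      by rewrite eqxx !(eq_sym _ a) (negbTE ab) (negbTE ac).
    + have [ad|ad] := eqVneq a d; last first.
        rewrite (@prodM_eq0 _ a)//= ?addr0// eqxx !(eq_sym _ a).
        by rewrite (negbTE ab) (negbTE ac) (negbTE ad).
      have [bc|bc] := eqVneq b c.
        rewrite -ad -bc ?eqxx /= !add0r.
        rewrite (permM _ [:: a; a; b; b]) ?two//.
        by apply/seq.permP => P /=; lia.
      rewrite (@prodM_eq0 _ b)//= ?addr0// eqxx !(eq_sym _ b).
      by rewrite (eq_sym b a) (negbTE ab) (negbTE bc) (negbTE bd).
by apply: eq_has_mean (has_mean_monomial _) => // z; rewrite !big_cons big_nil mulr1.
Qed.

Let kronecker (f : 'I_p -> R) a : \sum_b f b * (a == b)%:R = f a.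
Proof.
rewrite (bigD1 a)//= eqxx mulr1 big1 ?addr0// => b /negbTE ba.
by rewrite eq_sym ba mulr0.
Qed.

Context (A : 'M[R]_p).
Let S := A *m A^T.
Let X i (z : p.-tuple R) := \sum_(j < p) A i j * tnth z j.

Let SE i j : S i j = \sum_k A i k * A j k.
Proof. by rewrite mxE; apply: eq_bigr => k _; rewrite mxE. Qed.

Lemma has_mean_linear i : has_mean Z (X i) 0.
Proof.
have := has_mean_sum (index_enum 'I_p) (fun j => has_meanZ (A i j) (has_mean_tnth j)).
by rewrite big1// => j _; rewrite mulr0.
Qed.

Lemma has_mean_linear2 i j : has_mean Z (fun z => X i z * X j z) (S i j).
Proof.
have -> : S i j = \sum_a \sum_b A i a * A j b * (a == b)%:R.
  rewrite SE; apply: eq_bigr => a _.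
  by rewrite -(kronecker (fun b => A i a * A j b)).
apply: eq_has_mean (has_mean_sum _ (fun a => has_mean_sum _ (fun b =>
  has_meanZ (A i a * A j b) (has_mean_tnth2 a b)))) => z.
rewrite mulr_suml; apply: eq_bigr => a _; rewrite mulr_sumr; apply: eq_bigr => b _.
by rewrite mulrACA.
Qed.

(** Isserlis' formula for a general covariance, by multilinearity: the Kronecker symbols are
    contracted one index at a time, starting from the innermost sum. *)
Lemma has_mean_linear4 i j l m :
  has_mean Z (fun z => X i z * X j z * (X l z * X m z))
    (S i j * S l m + S i l * S j m + S i m * S j l).
Proof.
pose V a b c d : R := ((a == b) && (c == d))%:R + ((a == c) && (b == d))%:R +
     ((a == d) && (b == c))%:R.
have Vd a b c : \sum_d A m d * V a b c d =
    A m c * (a == b)%:R + A m b * (a == c)%:R + A m a * (b == c)%:R.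
  under eq_bigr do rewrite !mulrDr -!mulnb !natrM !mulrA.
  rewrite !big_split/=; congr (_ + _ + _).
  - by rewrite -(kronecker (fun d => A m d * (a == b)%:R)).
  - by rewrite -(kronecker (fun d => A m d * (a == c)%:R)).
  - rewrite -(kronecker (fun d => A m d * (b == c)%:R)).
    by apply: eq_bigr => d _; rewrite mulrAC.
have Vc a b : \sum_c A l c * \sum_d A m d * V a b c d =
    S l m * (a == b)%:R + A l a * A m b + A l b * A m a.
  under eq_bigr do rewrite Vd !mulrDr !mulrA.
  rewrite !big_split/= -mulr_suml -SE; congr (_ + _ + _).
  - by rewrite -(kronecker (fun c => A l c * A m b)).
  - by rewrite -(kronecker (fun c => A l c * A m a)).
have Vb a : \sum_b A j b * \sum_c A l c * \sum_d A m d * V a b c d =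
    A j a * S l m + A l a * S j m + A m a * S j l.
  under eq_bigr do rewrite Vc !mulrDr mulrA.
  rewrite !big_split/=; congr (_ + _ + _).
  - by rewrite -(kronecker (fun b => A j b * S l m)).
  - by rewrite SE mulr_sumr; apply: eq_bigr => b _; rewrite mulrCA.
  - by rewrite SE mulr_sumr; apply: eq_bigr => b _; rewrite mulrA mulrC.
have -> : S i j * S l m + S i l * S j m + S i m * S j l =
    \sum_a A i a * \sum_b A j b * \sum_c A l c * \sum_d A m d * V a b c d.
  under eq_bigr do rewrite Vb !mulrDr !mulrA.
  by rewrite !big_split/= -!mulr_suml -!SE.
apply: eq_has_mean (has_mean_sum _ (fun a => has_meanZ (A i a)
  (has_mean_sum _ (fun b => has_meanZ (A j b)
  (has_mean_sum _ (fun c => has_meanZ (A l c)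
  (has_mean_sum _ (fun d => has_meanZ (A m d) (has_mean_tnth4 a b c d))))))))) => z.
rewrite -mulrA /X mulr_suml; apply: eq_bigr => a _; rewrite -mulrA; congr (_ * _).
rewrite mulr_suml mulr_sumr; apply: eq_bigr => b _.
rewrite mulrCA -!mulrA; congr (_ * _).
rewrite mulr_suml !mulr_sumr; apply: eq_bigr => c _.
rewrite [in LHS]mulr_sumr !mulr_sumr; apply: eq_bigr => d _.
ring.
Qed.

End gaussian_moments.

Section gaussian_parameters.
Context (R : realType) (p : nat) (mu : p.-tuple R) (A : 'M[R]_p).

Definition gaussian : probability (p.-tuple R) R :=
  distribution (iid_law (std_normal R) p)
    (affine mu A : {mfun p.-tuple R >-> p.-tuple R}).

Notation G := gaussian.
Local Notation coord := Defs.coord.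
Local Notation cprod := Defs.cprod.
Notation Z := (iid_law (std_normal R) p).
Let S := A *m A^T.

Lemma is_normal_gaussian : is_normal mu S G.
Proof. by exists A. Qed.

Lemma measurable_coord i : measurable_fun setT (@Defs.coord R p i).
Proof. exact: measurable_tnth. Qed.

Let X i (z : p.-tuple R) := \sum_(j < p) A i j * tnth z j.

Let affineE i z : coord i (affine mu A z) = tnth mu i + X i z.
Proof. by rewrite /coord tnth_mktuple. Qed.

Lemma has_mean_coord i : has_mean G (coord i) (tnth mu i).
Proof.
apply: has_mean_distribution; first exact: measurable_coord.
have := has_meanD (has_mean_cst Z (tnth mu i)) (has_mean_linear A i).
by rewrite addr0; apply: eq_has_mean => z; rewrite affineE.
Qed.

Lemma mean_gaussian i : mean G i = tnth mu i.
Proof. by rewrite /mean (has_mean_expectation (has_mean_coord i)). Qed.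

Lemma covariance_coord i j : (covariance G (coord i) (coord j) = (S i j)%:E)%E.
Proof.
apply: has_mean_covariance (has_mean_coord i) (has_mean_coord j) _.
apply: has_mean_distribution.
  by apply: measurable_funM; apply: measurable_funB => //; exact: measurable_coord.
apply: eq_has_mean (has_mean_linear2 A i j) => z.
by rewrite !affineE ![tnth mu _ + _]addrC !addrK.
Qed.

Lemma sigma_gaussian i j : sigma G i j = S i j.
Proof. by rewrite /sigma covariance_coord. Qed.

Lemma measurable_cprod i j : measurable_fun setT (cprod G i j).
Proof.
by apply: measurable_funM; apply: measurable_funB => //; exact: measurable_coord.
Qed.

Let cprodE i j z : cprod G i j (affine mu A z) = X i z * X j z.
Proof. by rewrite /cprod !mean_gaussian !affineE ![tnth mu _ + _]addrC !addrK. Qed.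

Lemma has_mean_cprod i j : has_mean G (cprod G i j) (S i j).
Proof.
apply: has_mean_distribution; first exact: measurable_cprod.
by apply: eq_has_mean (has_mean_linear2 A i j) => z; rewrite cprodE.
Qed.

Lemma covariance_cprod i j l m :
  (covariance G (cprod G i j) (cprod G l m) = (S i l * S j m + S i m * S j l)%:E)%E.
Proof.
apply: has_mean_covariance (has_mean_cprod i j) (has_mean_cprod l m) _.
apply: has_mean_distribution.
  by apply: measurable_funM; apply: measurable_funB => //; exact: measurable_cprod.
have := has_meanD (has_meanB (has_mean_linear4 A i j l m)
   (has_meanZ (S l m) (has_mean_linear2 A i j)))
   (has_meanB (has_mean_cst Z (S i j * S l m))
     (has_meanZ (S i j) (has_mean_linear2 A l m))).
rewrite -/S => h; have := h; rewrite (_ : _ - _ + _ = S i l * S j m + S i m * S j l).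
  by apply: eq_has_mean => z; rewrite !cprodE /cst/= -?/(X _ _) -?/S; ring.
by ring.
Qed.

Lemma theta_gaussian i j : theta G i j = S i i * S j j + S i j ^+ 2.
Proof.
have SC : S j i = S i j.
  have /matrixP/(_ i j) : S^T = S by rewrite /S trmx_mul trmxK.
  by rewrite mxE.
by rewrite /theta /variance covariance_cprod /= SC expr2.
Qed.

Lemma rho_gaussian i j : rho G i j = S i j / (Num.sqrt (S i i) * Num.sqrt (S j j)).
Proof. by rewrite /rho /correlation /variance !covariance_coord. Qed.

Lemma rho4_gaussian i j l m :
  rho4 G i j l m = (S i l * S j m + S i m * S j l) /
    (Num.sqrt (theta G i j) * Num.sqrt (theta G l m)).
Proof. by rewrite /rho4 /correlation covariance_cprod. Qed.

Context (e : R) (e0 : 0 <= e <= 1) (S1 : forall i, S i i = 1)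
  (Se : forall i j, i != j -> `|S i j| <= e).

Lemma gaussian_assumption2 (tau : R) : 0 < tau < 1 ->
  (forall i, tau < sigma G i i < tau^-1) /\
  (forall i j, tau < theta G i j / (sigma G i i * sigma G j j)).
Proof.
move=> /andP[t0 t1]; split=> [i|i j].
  by rewrite sigma_gaussian S1 t1 invf_gt1.
by rewrite theta_gaussian !sigma_gaussian !S1 !mulr1 divr1 ltr_wpDr ?sqr_ge0.
Qed.

(** Two different ordered pairs of indices leave an off-diagonal factor in each of [S i l * S j m]
    and [S i m * S j l], so the covariance is at most [2 * e], while every [theta] is at least 1. *)
Lemma gaussian_assumption4 (rho0 : R) : 2 * e < 1 - rho0 ->
  (forall i j, i != j -> `|rho G i j| < 1 - rho0) /\
  (forall i j l m : 'I_p, (i <= j)%N -> (l <= m)%N -> (i, j) != (l, m) ->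
    `|rho4 G i j l m| < 1 - rho0).
Proof.
have /andP[e_ge0 e_le1] := e0; move=> er; split=> [i j ij|i j l m ij lm ijlm].
  rewrite rho_gaussian !S1 sqrtr1 mulr1 divr1 (le_lt_trans (Se ij))//.
  by apply: le_lt_trans er; rewrite mulr_natl mulr2n lerDl.
have S_le1 a b : `|S a b| <= 1.
  by have [<-|ab] := eqVneq a b; rewrite ?S1 ?normr1// (le_trans (Se ab)).
have SS_le a b c d : (a != b) || (c != d) -> `|S a b * S c d| <= e.
  rewrite normrM => /orP[ab|cd].
    by rewrite -[e]mulr1 ler_pM// Se.
  by rewrite -[e]mul1r ler_pM// Se.
have th1 a b : 1 <= Num.sqrt (theta G a b).
  rewrite -[leLHS]sqrtr1 ler_wsqrtr// theta_gaussian !S1 mulr1.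
  by rewrite lerDl sqr_ge0.
rewrite rho4_gaussian normrM normfV [X in _ / X]ger0_norm; last by rewrite mulr_ge0.
rewrite ltr_pdivrMr; last by rewrite mulr_gt0// (lt_le_trans _ (th1 _ _)).
apply: (@le_lt_trans _ _ (2 * e)).
  rewrite mulr_natl mulr2n (le_trans (ler_normD _ _))// lerD// SS_le//.
    by rewrite -negb_and -xpair_eqE.
  rewrite -negb_and; apply: contra ijlm => /andP[/eqP im /eqP jl].
  move: ij lm; rewrite im jl => ml lm.
  have /val_inj -> : val m = val l by apply/eqP; rewrite eqn_leq ml.
  by [].
have er0 : 0 <= 1 - rho0 by apply: le_trans (ltW er); apply: mulr_ge0.
by apply: (lt_le_trans er); rewrite ler_peMr// -[leLHS]mulr1 ler_pM.
Qed.

End gaussian_parameters.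

(** * Gaussian laws with a sparse covariance perturbation *)

Section coordinate_elimination.
Context (R : realType) (p : nat).
Notation phi := (std_normal R).
Notation Z := (iid_law phi p).
Local Open Scope ereal_scope.

Definition upd (x : p.-tuple R) (j : 'I_p) (a : R) : p.-tuple R :=
  [tuple if i == j then a else tnth x i | i < p].

Lemma tnth_upd_same x j a : tnth (upd x j a) j = a.
Proof. by rewrite tnth_mktuple eqxx. Qed.

Lemma tnth_upd_neq x j a i : i != j -> tnth (upd x j a) i = tnth x i.
Proof. by move=> /negbTE ij; rewrite tnth_mktuple ij. Qed.

Lemma measurable_upd d1 (X : measurableType d1) (f : X -> p.-tuple R) j (g : X -> R) :
  measurable_fun setT f -> measurable_fun setT g ->
  measurable_fun setT (fun x => upd (f x) j (g x)).
Proof.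
move=> mf mg; apply/measurable_fun_tnthP => i.
rewrite (_ : _ \o _ = fun x => if i == j then g x else tnth (f x) i).
  by case: (i == j) => //; exact: measurable_tuple_comp.
by apply/funext => x /=; rewrite tnth_mktuple.
Qed.

Lemma integral_upd j (K h : p.-tuple R -> \bar R) :
  measurable_fun setT K -> (forall x, 0 <= K x) -> depends_on (predC1 j) K ->
  measurable_fun setT h -> (forall x, 0 <= h x) ->
  \int[Z]_x (K x * h x) = \int[Z]_x (K x * \int[phi]_a h (upd x j a)).
Proof.
move=> mK K0 jK mh h0; rewrite (@integral_elim _ _ _ _ _ (pred1 j))//.
apply: eq_integral => x _; congr (_ * _).
rewrite -(@integral_iid_law_tnth _ _ _ phi p j (fun a => h (upd x j a)))//.
- apply: eq_integral => y _; congr h; apply: eq_from_tnth => i.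
  by rewrite !tnth_mktuple /=; case: eqP => // ->.
- by apply: measurableT_comp => //; exact: measurable_upd.
Qed.

Context (d s : R) (s0 : (0 < s)%R) (ds : (d ^+ 2 + s ^+ 2 = 1)%R).

Definition edge_ratio (e : 'I_p * 'I_p) (z : p.-tuple R) : R :=
  pair_ratio d s (tnth z e.1) (tnth z e.2).

Lemma edge_ratio_ge0 e z : (0 <= edge_ratio e z)%R.
Proof. exact: pair_ratio_ge0. Qed.

Lemma edge_ratioE_ge0 e z : 0 <= (edge_ratio e z)%:E.
Proof. by rewrite lee_fin edge_ratio_ge0. Qed.

Lemma measurable_edge_ratio e : measurable_fun setT (edge_ratio e).
Proof. by apply: measurable_pair_ratio; exact: measurable_tnth. Qed.

Lemma measurable_edge_ratioE e : measurable_fun setT (fun z => (edge_ratio e z)%:E).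
Proof. by apply/measurable_EFinP; exact: measurable_edge_ratio. Qed.

Lemma depends_on_edge_ratio (J : pred 'I_p) e :
  J e.1 -> J e.2 -> depends_on J (edge_ratio e).
Proof. by move=> J1 J2 x y xy; rewrite /edge_ratio !xy. Qed.

Hint Resolve edge_ratio_ge0 edge_ratioE_ge0 measurable_edge_ratio measurable_edge_ratioE : core.

(** For any value of the other endpoint, integrating out [j] leaves mass 1. An edge therefore
    disappears as soon as the rest of the integrand ignores one of its endpoints. *)
Lemma integral_edge_ratio e j (K : p.-tuple R -> \bar R) :
  e.1 != e.2 -> j \in [:: e.1; e.2] ->
  measurable_fun setT K -> (forall x, 0 <= K x) -> depends_on (predC1 j) K ->
  \int[Z]_x (K x * (edge_ratio e x)%:E) = \int[Z]_x K x.
Proof.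
move=> e12 je mK K0 jK; rewrite (integral_upd mK K0 jK)//.
apply: eq_integral => x _; rewrite [X in _ * X](_ : _ = 1) ?mule1// /edge_ratio.
move: je; rewrite !inE => /orP[] /eqP ->.
  under eq_integral do rewrite tnth_upd_same tnth_upd_neq 1?eq_sym// pair_ratioC.
  exact: integral_pair_ratio1.
under eq_integral do rewrite tnth_upd_same tnth_upd_neq//.
exact: integral_pair_ratio1.
Qed.

Lemma integral_edge_ratio_sqr e (K : p.-tuple R -> \bar R) :
  e.1 != e.2 -> measurable_fun setT K -> (forall x, 0 <= K x) ->
  depends_on (predC1 e.1) K -> depends_on (predC1 e.2) K ->
  \int[Z]_x (K x * ((edge_ratio e x) ^+ 2)%:E) = \int[Z]_x K x * (s ^- 2)%:E.
Proof.
move=> e12 mK K0 K1 K2.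
have msq : measurable_fun setT (fun z : R * R => (pair_ratio d s z.1 z.2 ^+ 2)%:E).
  apply/measurable_EFinP; apply: measurable_funX.
  exact: measurable_pair_ratio.
have msq0 (z : R * R) : 0 <= (pair_ratio d s z.1 z.2 ^+ 2)%:E.
  by rewrite lee_fin sqr_ge0.
pose k x1 := \int[phi]_x2 (pair_ratio d s x1 x2 ^+ 2)%:E.
have mk : measurable_fun setT k by exact: (measurable_fun_fubini_tonelli_F _ msq).
have k0 x1 : 0 <= k x1 by apply: integral_ge0 => x2 _; exact: (msq0 (x1, x2)).
rewrite (integral_upd mK K0 K2)//; last 2 first.
- by apply/measurable_EFinP; exact: measurable_funX.
- by move=> x; rewrite lee_fin sqr_ge0.
transitivity (\int[Z]_x (K x * k (tnth x e.1))).
  apply: eq_integral => x _; congr (_ * _); apply: eq_integral => a _.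
  by rewrite /edge_ratio tnth_upd_same tnth_upd_neq.
rewrite (integral_upd mK K0 K1)//; last first.
  by apply: measurableT_comp => //; exact: measurable_tnth.
under eq_integral => x _.
  under eq_integral do rewrite tnth_upd_same.
  rewrite /k integral_pair_ratio_sqr//; over.
by rewrite ge0_integralZr// lee_fin invr_ge0 sqr_ge0.
Qed.

(* The edges act one after the other: the matching matrix is a composition of
   such steps. *)
Definition step (e : 'I_p * 'I_p) (z : p.-tuple R) : p.-tuple R :=
  upd z e.2 (d * tnth z e.1 + s * tnth z e.2)%R.

Lemma measurable_step e : measurable_fun setT (step e).
Proof.
apply: measurable_upd => //.
by apply: measurable_funD; apply: measurable_funM => //; exact: measurable_tnth.
Qed.

(** The factor [K], blind to the updated coordinate, carries the ratios of the other edges through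
    the induction over the matching. *)
Lemma integral_step e (f K : p.-tuple R -> \bar R) : e.1 != e.2 ->
  measurable_fun setT K -> (forall x, 0 <= K x) -> depends_on (predC1 e.2) K ->
  measurable_fun setT f -> (forall x, 0 <= f x) ->
  \int[Z]_x (K x * f (step e x)) = \int[Z]_x (K x * (f x * (edge_ratio e x)%:E)).
Proof.
move=> e12 mK K0 K2 mf f0.
have mfs : measurable_fun setT (fun x => f (step e x)).
  by apply: measurableT_comp => //; exact: measurable_step.
have mfe : measurable_fun setT (fun x => f x * (edge_ratio e x)%:E).
  exact: emeasurable_funM.
rewrite (integral_upd mK K0 K2 mfs (fun=> f0 _)).
rewrite (integral_upd mK K0 K2 mfe (fun=> mule_ge0 (f0 _) (edge_ratioE_ge0 _ _))).
apply: eq_integral => x _; congr (_ * _).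
have mfu : measurable_fun setT (fun a => f (upd x e.2 a)).
  by apply: measurableT_comp => //; exact: measurable_upd.
have := integral_pair_ratio s0 ds (tnth x e.1) mfu (fun a => f0 _).
have -> : \int[phi]_a f (step e (upd x e.2 a)) =
    \int[phi]_a f (upd x e.2 (d * tnth x e.1 + s * a)%R).
  apply: eq_integral => a _; congr f; rewrite /step tnth_upd_same tnth_upd_neq//.
  by apply: eq_from_tnth => i; rewrite !tnth_mktuple; case: eqP.
move=> ->; apply: eq_integral => a _.
by rewrite /edge_ratio tnth_upd_same tnth_upd_neq.
Qed.

End coordinate_elimination.

Section matching.
Context (R : realType) (p : nat) (d s : R).
Context (s0 : 0 < s) (ds : d ^+ 2 + s ^+ 2 = 1).
Notation Z := (iid_law (std_normal R) p).

Definition disjoint_edges (e f : 'I_p * 'I_p) :=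
  [&& e.1 != f.1, e.1 != f.2, e.2 != f.1 & e.2 != f.2].

Context (I : finType).

Definition matching (e : I -> 'I_p * 'I_p) :=
  (forall b, (e b).1 != (e b).2) /\
  (forall b b', b != b' -> disjoint_edges (e b) (e b')).

Definition matching_ratio (e : I -> 'I_p * 'I_p) (P : pred I) (z : p.-tuple R) : R :=
  \prod_(b | P b) edge_ratio d s (e b) z.

Lemma matching_ratio_ge0 e P z : 0 <= matching_ratio e P z.
Proof. by apply: prodr_ge0 => b _; exact: edge_ratio_ge0. Qed.

Lemma measurable_matching_ratio e P : measurable_fun setT (matching_ratio e P).
Proof.
rewrite /matching_ratio; under eq_fun do rewrite big_mkcond.
apply: measurable_prod => b _; case: (P b); last exact: measurable_cst.
exact: measurable_edge_ratio.
Qed.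

Lemma depends_on_prod (J : pred 'I_p) (r : seq I) (P : pred I) (F : I -> p.-tuple R -> R) :
  (forall b, P b -> depends_on J (F b)) ->
  depends_on J (fun z => \prod_(b <- r | P b) F b z).
Proof. by move=> JF x y xy; apply: eq_bigr => b Pb; exact: JF. Qed.

Lemma depends_on_matching_ratio (J : pred 'I_p) e (P : pred I) :
  (forall b, P b -> J (e b).1 && J (e b).2) -> depends_on J (matching_ratio e P).
Proof.
by move=> eJ; apply: depends_on_prod => b /eJ/andP[? ?]; exact: depends_on_edge_ratio.
Qed.

(* For an edge [(i, j)], row [j] maps [Z] to [d * Z_i + s * Z_j]; the other rows
   are those of the identity. *)
Definition matching_mx (e : I -> 'I_p * 'I_p) : 'M[R]_p :=
  \matrix_(i, j) if [pick b | (e b).2 == i] is Some b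
    then d * ((e b).1 == j)%:R + s * ((e b).2 == j)%:R else (i == j)%:R.

Context (e : I -> 'I_p * 'I_p) (e_matching : matching e).

Let e12 b : (e b).1 != (e b).2. Proof. by have [+ _] := e_matching; exact. Qed.

Let e11 b b' : ((e b).1 == (e b').1) = (b == b').
Proof.
have [<-|bb'] := eqVneq b b'; first by rewrite eqxx.
by have [_ /(_ _ _ bb') /and4P[/negbTE ->]] := e_matching.
Qed.

Let e22 b b' : ((e b).2 == (e b').2) = (b == b').
Proof.
have [<-|bb'] := eqVneq b b'; first by rewrite eqxx.
by have [_ /(_ _ _ bb') /and4P[_ _ _ /negbTE ->]] := e_matching.
Qed.

Let e12' b b' : ((e b).1 == (e b').2) = false.
Proof.
have [<-|bb'] := eqVneq b b'; first exact/negbTE.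
by have [_ /(_ _ _ bb') /and4P[_ /negbTE ->]] := e_matching.
Qed.

Let e21 b b' : ((e b).2 == (e b').1) = false.
Proof. by rewrite eq_sym e12'. Qed.

Definition edge_of (i j : 'I_p) := [exists b, e b == (i, j)].

Lemma matching_mx_cov i j : (matching_mx e *m (matching_mx e)^T) i j =
  (i == j)%:R + d * (edge_of i j || edge_of j i)%:R.
Proof.
rewrite mxE; under eq_bigr do rewrite !mxE.
have kron (f : 'I_p -> R) a : \sum_k f k * (a == k)%:R = f a.
  rewrite (bigD1 a)//= eqxx mulr1 big1 ?addr0// => k /negbTE ka.
  by rewrite eq_sym ka mulr0.
have edge1 b j' : edge_of (e b).1 j' = (j' == (e b).2).
  apply/existsP/eqP => [[b' /eqP]|->]; last by exists b; case: (e b).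
  by case E : (e b') => [x y] [x1 <-]; have := e11 b' b; rewrite E/= x1 eqxx => /esym/eqP <-; rewrite E.
have edge2 b i' : edge_of i' (e b).2 = (i' == (e b).1).
  apply/existsP/eqP => [[b' /eqP]|->]; last by exists b; case: (e b).
  by case E : (e b') => [x y] [<- y2]; have := e22 b' b; rewrite E/= y2 eqxx => /esym/eqP <-; rewrite E.
have edge2N j' i' : (forall b, (e b).2 != j') -> edge_of i' j' = false.
  by move=> jN; apply/existsP => -[b /eqP eb]; have := jN b; rewrite eb eqxx.
have edge1N b j' : edge_of (e b).2 j' = false.
  by apply/existsP => -[b' /eqP eb']; have := e21 b b'; rewrite eb' eqxx.
case: pickP => [b /eqP bi|iN]; case: pickP => [b' /eqP bj|jN].
- rewrite -bi -bj; under eq_bigr do rewrite mulrDr 2!mulrA.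
  rewrite big_split/= !kron !e11 !e22 !e12' !e21 !edge1N mulr0 addr0.
  by rewrite !mulr0 addr0 add0r mulrAC -expr2 (mulrAC s) -expr2 -mulrDl [b == b']eq_sym ds mul1r.
- under eq_bigr do rewrite eq_sym; rewrite kron -bi.
  have /negbTE -> : (e b).2 != j by rewrite (negbT (jN b)).
  rewrite mulr0 addr0 add0r edge1N edge2 eq_sym.
  by rewrite eq_sym.
- under eq_bigr do rewrite mulrC; rewrite kron -bj.
  have /negbTE iN' : (e b').2 != i by rewrite (negbT (iN b')).
  by rewrite iN' (eq_sym i) iN' mulr0 addr0 add0r edge1N orbF edge2 eq_sym.
- rewrite (edge2N j) ?(edge2N i) ?mulr0 ?addr0; last 2 first.
  + by move=> b; rewrite (negbT (iN b)).
  + by move=> b; rewrite (negbT (jN b)).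
  by rewrite kron eq_sym.
Qed.

Let steps bs z : p.-tuple R := foldr (fun b f z => f (step d s (e b) z)) id bs z.

Let steps_notin bs z i : (forall b, b \in bs -> (e b).2 != i) ->
  tnth (steps bs z) i = tnth z i.
Proof.
elim: bs z => [//|b bs IH] z bsi /=; rewrite /steps/= -/(steps _ _) IH => [|b' b'bs].
  by rewrite tnth_upd_neq// eq_sym bsi// mem_head.
by rewrite bsi// inE b'bs orbT.
Qed.

Let steps_in bs z b : uniq bs -> b \in bs ->
  tnth (steps bs z) (e b).2 = d * tnth z (e b).1 + s * tnth z (e b).2.
Proof.
elim: bs z => [//|b' bs IH] z /= /andP[b'bs ubs].
rewrite inE /steps/= -/(steps _ _); case: (eqVneq b b') => [->|bb' /= bbs].
  rewrite steps_notin ?tnth_upd_same// => b'' b''bs.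
  by rewrite e22; apply: contraNneq b'bs => <-.
by rewrite IH// !tnth_upd_neq ?e22 ?e12'.
Qed.

Let measurable_steps bs : measurable_fun setT (steps bs).
Proof.
elim: bs => [|b bs IH]; first exact: measurable_id.
exact: measurableT_comp IH (@measurable_step _ _ _ _ _).
Qed.

(** No step reads a coordinate that another step writes, so the composed steps act independently on
    the edges, as the rows of the matrix do. *)
Let stepsE z : affine [tuple 0 | _ < p] (matching_mx e) z = steps (index_enum I) z.
Proof.
apply: eq_from_tnth => i; rewrite !tnth_mktuple add0r.
under eq_bigr do rewrite mxE.
have kron (f : 'I_p -> R) a : \sum_k (a == k)%:R * f k = f a.
  rewrite (bigD1 a)//= eqxx mul1r big1 ?addr0// => k /negbTE ka.
  by rewrite eq_sym ka mul0r.
case: pickP => [b /eqP <-|iN].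
  under eq_bigr do rewrite mulrDl -!mulrA.
  by rewrite big_split/= -!mulr_sumr !kron steps_in ?index_enum_uniq// mem_index_enum.
by rewrite kron steps_notin// => b _; rewrite (negbT (iN b)).
Qed.

Local Open Scope ereal_scope.

Let integral_steps bs (f K : p.-tuple R -> \bar R) : uniq bs ->
  measurable_fun setT K -> (forall x, 0 <= K x) ->
  (forall b, b \in bs -> depends_on (predC1 (e b).2) K) ->
  measurable_fun setT f -> (forall x, 0 <= f x) ->
  \int[Z]_x (K x * f (steps bs x)) =
  \int[Z]_x (K x * (f x * (\prod_(b <- bs) edge_ratio d s (e b) x)%:E)).
Proof.
move=> + mK K0 + mf f0; elim: bs K mK K0 => [|b bs IH] K mK K0.
  by move=> _ _; apply: eq_integral => x _; rewrite big_nil mule1.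
move=> /= /andP[bbs ubs] KJ.
have mfs : measurable_fun setT (fun x => f (steps bs x)).
  by apply: measurableT_comp => //; exact: measurable_steps.
have mKr : measurable_fun setT (fun x => K x * (edge_ratio d s (e b) x)%:E).
  by apply: emeasurable_funM => //; exact: measurable_edge_ratioE.
transitivity (\int[Z]_x (K x * (f (steps bs x) * (edge_ratio d s (e b) x)%:E))).
  exact: (integral_step s0 ds (e12 b) mK K0 (KJ b (mem_head _ _)) mfs (fun=> f0 _)).
transitivity (\int[Z]_x ((K x * (edge_ratio d s (e b) x)%:E) * f (steps bs x))).
  by apply: eq_integral => x _; rewrite muleCA -!muleA muleC -muleA.
rewrite IH//; last 2 first.
- by move=> x; rewrite mule_ge0// edge_ratioE_ge0.
- move=> b' b'bs x y xy; rewrite (KJ b' _ x y xy) ?inE ?b'bs ?orbT//.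
  rewrite (@depends_on_edge_ratio _ _ _ _ (predC1 (e b').2) (e b) _ _ x y)//=.
    by rewrite e12'.
  by rewrite e22; apply: contraNneq bbs => ->.
by apply: eq_integral => x _; rewrite big_cons [in RHS]EFinM -muleA (muleCA (f x)).
Qed.

Lemma integral_affine_matching (f : p.-tuple R -> \bar R) :
  measurable_fun setT f -> (forall x, 0 <= f x) ->
  \int[Z]_x f (affine [tuple 0%R | _ < p] (matching_mx e) x) =
  \int[Z]_x (f x * (matching_ratio e xpredT x)%:E).
Proof.
move=> mf f0; have m1 : measurable_fun [set: p.-tuple R] (cst 1 : _ -> \bar R).
  exact: measurable_cst.
have := @integral_steps (index_enum I) f (cst 1) (index_enum_uniq _) m1
  (fun=> lee01) (fun _ _ _ _ _ => erefl) mf f0.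
under eq_integral do rewrite mul1e -stepsE.
by under [RHS]eq_integral do rewrite mul1e.
Qed.

Lemma has_density_gaussian_matching (mu : p.-tuple R) :
  has_density (gaussian mu (matching_mx e)) (gaussian mu 1%:M)
    (fun x => matching_ratio e xpredT [tuple tnth x i - tnth mu i | i < p])%R.
Proof.
have mcenter : measurable_fun setT
    (fun x : p.-tuple R => [tuple tnth x i - tnth mu i | i < p])%R.
  apply/measurable_fun_tnthP => i.
  rewrite (_ : _ \o _ = fun x : p.-tuple R => tnth x i - tnth mu i)%R.
    by apply: measurable_funB => //; exact: measurable_tnth.
  by apply/funext => x /=; rewrite tnth_mktuple.
have mshift : measurable_fun setT
    (fun x : p.-tuple R => [tuple tnth mu i + tnth x i | i < p])%R.
  apply/measurable_fun_tnthP => i.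
  rewrite (_ : _ \o _ = fun x : p.-tuple R => tnth mu i + tnth x i)%R.
    by apply: measurable_funD => //; exact: measurable_tnth.
  by apply/funext => x /=; rewrite tnth_mktuple.
have mratio : measurable_fun setT
    (fun x : p.-tuple R => matching_ratio e xpredT [tuple tnth x i - tnth mu i | i < p])%R.
  by apply: measurableT_comp => //; exact: measurable_matching_ratio.
split; [exact: mratio|by move=> x; exact: matching_ratio_ge0|move=> g mg g0].
have affine1 z : affine mu 1%:M z = [tuple tnth mu i + tnth z i | i < p]%R.
  apply: eq_from_tnth => i; rewrite !tnth_mktuple; congr (_ + _)%R.
  rewrite (bigD1 i)//= mxE eqxx mul1r big1 ?addr0// => j ji.
  by rewrite mxE eq_sym (negbTE ji) mul0r.
rewrite !ge0_integral_distribution//; last 2 first.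
- by apply: emeasurable_funM => //; exact/measurable_EFinP.
- by move=> x; rewrite mule_ge0// lee_fin matching_ratio_ge0.
transitivity (\int[Z]_x g [tuple tnth mu i
    + tnth (affine [tuple 0%R | _ < p] (matching_mx e) x) i | i < p]%R).
  apply: eq_integral => x _ /=; congr g; apply: eq_from_tnth => i.
  by rewrite !tnth_mktuple add0r.
have mgs : measurable_fun setT (fun x => g [tuple tnth mu i + tnth x i | i < p]%R).
  exact: measurableT_comp.
rewrite (integral_affine_matching mgs (fun=> g0 _)); apply: eq_integral => x _ /=.
rewrite affine1; congr (_ * (matching_ratio _ _ _)%:E).
by apply: eq_from_tnth => i; rewrite !tnth_mktuple addrC addKr.
Qed.

End matching.

Section matching_second_moment.
Context (R : realType) (p : nat) (d s : R).
Context (s0 : 0 < s) (ds : d ^+ 2 + s ^+ 2 = 1).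
Notation Z := (iid_law (std_normal R) p).
Notation ratio := (edge_ratio d s).
Local Open Scope ereal_scope.

(** The hypotheses let [e] and [f] meet only in their first or in their second ends. If they differ,
    [f] has an endpoint that [e] misses; integrating it out removes [f], after which [e] goes
    too. *)
Lemma integral_edge_ratioM (e f : 'I_p * 'I_p) (K : p.-tuple R -> \bar R) :
  e.1 != e.2 -> f.1 != f.2 -> e.1 != f.2 -> e.2 != f.1 ->
  measurable_fun setT K -> (forall x, 0 <= K x) ->
  (forall j, j \in [:: e.1; e.2; f.1; f.2] -> depends_on (predC1 j) K) ->
  \int[Z]_x (K x * (ratio e x * ratio f x)%:E) =
  \int[Z]_x K x * (if e == f then s ^- 2 else 1)%:E.
Proof.
move=> e12 f12 ef12 ef21 mK K0 Kj.
have [<-|ef] := eqVneq e f.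
  under eq_integral do rewrite -expr2.
  by rewrite (integral_edge_ratio_sqr s0 ds e12)//; apply: Kj; rewrite !inE eqxx ?orbT.
have [j jf je] : exists2 j, j \in [:: f.1; f.2] & j \notin [:: e.1; e.2].
  have [e1f1|e1f1] := eqVneq e.1 f.1; last first.
    by exists f.1; rewrite !inE ?eqxx// negb_or eq_sym e1f1 eq_sym.
  exists f.2; rewrite !inE ?eqxx ?orbT// negb_or (eq_sym f.2) ef12/=.
  apply: contraNneq ef => e2f2; case: e f e1f1 e2f2 {e12 f12 ef12 ef21 Kj} => a b [a' b'] /= -> ->.
  by [].
have mKe : measurable_fun setT (fun x => K x * (ratio e x)%:E).
  by apply: emeasurable_funM => //; exact: measurable_edge_ratioE.
have Ke0 x : 0 <= K x * (ratio e x)%:E by rewrite mule_ge0// edge_ratioE_ge0.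
under eq_integral do rewrite EFinM muleA.
rewrite (integral_edge_ratio s0 ds f12 jf mKe Ke0); last first.
  move=> x y xy; rewrite (Kj j _ x y xy); last first.
    by move: jf; rewrite !inE => /orP[] ->; rewrite !orbT.
  move: je; rewrite !inE negb_or => /andP[je1 je2].
  by rewrite (@depends_on_edge_ratio _ _ _ _ (predC1 j) e _ _ x y)//= eq_sym.
rewrite (integral_edge_ratio s0 ds e12 (mem_head _ _) mK K0) ?mule1//.
by apply: Kj; rewrite !inE eqxx.
Qed.

Context (I : finType) (e f : I -> 'I_p * 'I_p).

Lemma integral_matching_ratioM :
  (forall b, [&& (e b).1 != (e b).2, (f b).1 != (f b).2,
    (e b).1 != (f b).2 & (e b).2 != (f b).1]) ->
  (forall b b', b != b' -> [&& disjoint_edges (e b) (e b'),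
    disjoint_edges (e b) (f b'), disjoint_edges (f b) (e b') &
    disjoint_edges (f b) (f b')]) ->
  \int[Z]_x (matching_ratio d s e xpredT x * matching_ratio d s f xpredT x)%:E =
  (\prod_b (if e b == f b then s ^- 2 else 1))%:E.
Proof.
move=> ef1 ef2; rewrite /matching_ratio.
under eq_integral do rewrite -big_split/=.
elim: (index_enum I) (index_enum_uniq I) => [_|b bs IH /= /andP[bbs ubs]].
  under eq_integral do rewrite big_nil.
  by rewrite big_nil integral_cst//= probability_setT mule1.
under eq_integral do rewrite big_cons mulrC EFinM.
have /and4P[e12 f12 ef12 ef21] := ef1 b.
rewrite integral_edge_ratioM//.
- by rewrite IH// big_cons -EFinM mulrC.
- apply/measurable_EFinP; apply: measurable_prod => b' _.
  by apply: measurable_funM; exact: measurable_edge_ratio.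
- by move=> x; rewrite lee_fin prodr_ge0// => b' _; rewrite mulr_ge0 ?edge_ratio_ge0.
move=> j jef x y xy; congr EFin; rewrite !big_seq; apply: eq_bigr => b' b'bs.
have bb' : b != b' by apply: contraNneq bbs => ->.
have /and4P[/and4P[h1 h2 h3 h4] /and4P[h5 h6 h7 h8] /and4P[h9 h10 h11 h12]
  /and4P[h13 h14 h15 h16]] := ef2 _ _ bb'.
by rewrite !(@depends_on_edge_ratio _ _ _ _ (predC1 j) _ _ _ x y)//= eq_sym;
  move: jef; rewrite !inE => /or4P[] /eqP ->.
Qed.

End matching_second_moment.

(** * Testing against a mixture of alternatives *)

Section likelihood_ratio_bound.
Context d (T : measurableType d) (R : realType) (P : probability T R).

Lemma has_mean_le (f g : T -> R) a b : (forall x, f x <= g x) ->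
  has_mean P f a -> has_mean P g b -> a <= b.
Proof.
move=> fg [fi fa] [gi gb]; rewrite -lee_fin -fa -gb.
by apply: le_integral => // x _ /=; rewrite lee_fin.
Qed.

Lemma has_mean_bounded (w L : T -> R) a : measurable_fun setT w ->
  (forall x, 0 <= w x <= 1) -> (forall x, 0 <= L x) -> has_mean P L a ->
  has_mean P (fun x => w x * L x) (fine (\int[P]_x (w x * L x)%:E)%E).
Proof.
move=> mw w01 L0 La; have [Li _] := La; have mL := has_mean_measurable La.
have wLi : P.-integrable setT (EFin \o (fun x => w x * L x)).
  apply: (le_integrable measurableT _ _ Li) => [|x _ /=].
    by apply/measurable_EFinP; exact: measurable_funM.
  have /andP[wx0 wx1] := w01 x.
  by rewrite lee_fin !ger0_norm ?mulr_ge0// ler_piMl.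
by split => //; rewrite fineK//; exact: integrable_fin_num.
Qed.

(** A pointwise substitute for the Cauchy-Schwarz inequality: a first moment is bounded by a second
    one at the price of the free parameter [e]. It serves the test bound and the mixing bound
    alike. *)
Lemma ler_amgm (t e : R) : 0 < e -> t <= 1 + e + (t - 1) ^+ 2 / (4 * e).
Proof.
move=> e0; rewrite -subr_ge0.
have -> : 1 + e + (t - 1) ^+ 2 / (4 * e) - t = (2 * e - (t - 1)) ^+ 2 / (4 * e).
  by field; rewrite gt_eqF.
by rewrite divr_ge0 ?sqr_ge0// mulr_ge0// ltW.
Qed.

(* Le Cam's bound in chi-squared form, for the mixture of the laws with
   densities [L j]. *)
Lemma mixture_test_bound (J : finType) (L : J -> T -> R) (c : J -> J -> R)
    (w : T -> R) (alpha V e : R) :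
  (0 < #|J|)%N -> (forall j x, 0 <= L j x) -> (forall j, has_mean P (L j) 1) ->
  (forall j k, has_mean P (fun x => L j x * L k x) (c j k)) ->
  \sum_j \sum_k c j k <= V * #|J|%:R ^+ 2 ->
  measurable_fun setT w -> (forall x, 0 <= w x <= 1) ->
  (\int[P]_x (w x)%:E <= alpha%:E)%E -> 0 < e ->
  exists j, (\int[P]_x (w x * L j x)%:E <= (alpha + e + (V - 1) / (4 * e))%:E)%E.
Proof.
move=> J0 L0 L1 LL cV mw w01 walpha e0.
pose N : R := #|J|%:R; have N0 : 0 < N by rewrite ltr0n.
pose u j := fine (\int[P]_x (w x * L j x)%:E)%E.
have uP j : has_mean P (fun x => w x * L j x) (u j) by exact: has_mean_bounded (L1 j).
have wP : has_mean P w (fine (\int[P]_x (w x)%:E)%E).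
  have := has_mean_bounded mw w01 (fun=> ler01) (has_mean_cst P 1).
  by rewrite /cst; under eq_integral do rewrite mulr1; apply: eq_has_mean => x; rewrite mulr1.
set a := fine _ in wP; have [_ aE] := wP.
have aalpha : a <= alpha by rewrite -lee_fin -aE.
have a1 : a <= 1.
  by apply: has_mean_le wP (has_mean_cst P 1) => x; have /andP[] := w01 x.
pose Lm x := N^-1 * \sum_j L j x.
have Lm1 : has_mean P Lm 1.
  have := has_meanZ N^-1 (has_mean_sum (index_enum J) L1).
  by rewrite sumr_const mulVf ?gt_eqF.
have LmLm : has_mean P (fun x => Lm x ^+ 2) (N ^- 2 * \sum_j \sum_k c j k).
  have := has_meanZ (N ^- 2) (has_mean_sum (index_enum J) (fun j =>
    has_mean_sum (index_enum J) (LL j))).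
  apply: eq_has_mean => x; rewrite /Lm exprMn exprVn; congr (_ * _).
  by rewrite expr2 mulr_suml; apply: eq_bigr => j _; rewrite mulr_sumr.
set V' := N ^- 2 * _ in LmLm.
have V'V : V' <= V by rewrite /V' ler_pdivrMl ?exprn_gt0// mulrC.
have Lm_var : has_mean P (fun x => (Lm x - 1) ^+ 2) (V' - 2 * 1 + 1).
  apply: eq_has_mean (has_meanD (has_meanB LmLm (has_meanZ 2 Lm1)) (has_mean_cst P 1)) => x.
  by rewrite /cst; ring.
have wLm : has_mean P (fun x => w x * Lm x) (N^-1 * \sum_j u j).
  apply: eq_has_mean (has_meanZ N^-1 (has_mean_sum (index_enum J) uP)) => x.
  by rewrite /Lm mulrCA -mulr_sumr.
have avg : N^-1 * \sum_j u j <= alpha + e + (V - 1) / (4 * e).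
  (* Integrate the pointwise bound [w * Lm <= (1 + e) * w + (Lm - 1) ^+ 2 / (4 * e)], which uses
     [w <= 1] in its last term. *)
  apply: (@le_trans _ _ ((1 + e) * a + (4 * e)^-1 * (V' - 2 * 1 + 1))).
    apply: has_mean_le wLm (has_meanD (has_meanZ (1 + e) wP) (has_meanZ (4 * e)^-1 Lm_var)).
    move=> x; have /andP[wx0 wx1] := w01 x.
    apply: (@le_trans _ _ (w x * (1 + e + (Lm x - 1) ^+ 2 / (4 * e)))).
      by rewrite ler_wpM2l// ler_amgm.
    rewrite mulrDr mulrC lerD2l [leRHS]mulrC ler_piMl// divr_ge0 ?sqr_ge0//.
    by rewrite mulr_ge0// ltW.
  rewrite mulrDl mul1r lerD//.
    by rewrite lerD// ler_piMr// ltW.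
  rewrite mulrC ler_pM2r ?invr_gt0 ?mulr_gt0//; lra.
have [j uj] : exists j, u j <= alpha + e + (V - 1) / (4 * e).
  apply: contrapT => /forallNP uN; move: avg; apply/negP; rewrite -ltNge.
  rewrite ltr_pdivlMl//.
  set B := alpha + e + _; have -> : N * B = \sum_(j : J) B by rewrite sumr_const mulr_natl.
  have /card_gt0P[j0 _] := J0.
  rewrite (bigD1 j0)//= [ltRHS](bigD1 j0)//= ltr_leD//.
    by rewrite ltNge; apply/negP/uN.
  by apply: ler_sum => j _; rewrite leNgt; apply/negP => /ltW; exact: uN.
by exists j; have [_ ->] := uP j; rewrite lee_fin.
Qed.

End likelihood_ratio_bound.

(** * Mixing *)

Section beta_coefficient.
Context (R : realType).

Lemma sum_indic_partition (T : Type) n (A : 'I_n -> set T) (x : T) :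
  partition [set: 'I_n] A [set: T] -> \sum_(k < n) (\1_(A k) x : R) = 1.
Proof.
move=> [covA trivA _]; have : cover [set: 'I_n] A x by rewrite covA.
move=> [k _ Akx]; rewrite (bigD1 k)//= indicE mem_set// big1 ?addr0// => k' k'k.
rewrite indicE memNset// => Ak'x; move/eqP: k'k; apply.
by apply: trivA => //; exists x.
Qed.

(** The indicators of the cells of a partition sum to 1, so the dominating integrals add up to the
    mean of [h] for every pair of partitions. *)
Lemma beta_coef_le d (T : measurableType d) d' (T' : measurableType d')
    (F : probability T R) (AA BB : set (set T)) (Q : probability T' R)
    (sh : T' -> T) (h : T' -> R) (B : R) :
  measurable_fun setT sh -> AA `<=` measurable -> BB `<=` measurable ->
  (forall z, 0 <= h z) -> has_mean Q h B ->
  (forall A1 B1, AA A1 -> BB B1 ->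
    (`|F (A1 `&` B1) - F A1 * F B1| <=
     \int[Q]_z (\1_A1 (sh z) * \1_B1 (sh z) * h z)%:E)%E) ->
  (beta_coef F AA BB <= (2^-1 * B)%:E)%E.
Proof.
move=> msh mAA mBB h0 hB AB; have mh := has_mean_measurable hB.
have mind A1 : measurable A1 -> measurable_fun setT (fun z => \1_A1 (sh z) : R).
  by move=> mA1; apply: measurableT_comp => //; exact: measurable_indic.
rewrite /beta_coef EFinM lee_pmul2l//; apply: ge_ereal_sup => _
  [u1 [u2 [A1 [B1 [[AA1 pA1] [BB1 pB1] ->]]]]].
apply: (@le_trans _ _ (\sum_(k < u1) \sum_(k' < u2)
    \int[Q]_z (\1_(A1 k) (sh z) * \1_(B1 k') (sh z) * h z)%:E)%E).
  by apply: lee_sum => k _; apply: lee_sum => k' _; exact: AB.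
have [_ <-] := hB.
have mABh k k' : measurable_fun setT
    (fun z => (\1_(A1 k) (sh z) * \1_(B1 k') (sh z) * h z)%:E).
  by apply/measurable_EFinP; do 2 (apply: measurable_funM => //); apply: mind;
    [exact: mAA|exact: mBB].
have ABh0 k k' z : (0 <= (\1_(A1 k) (sh z) * \1_(B1 k') (sh z) * h z)%:E)%E.
  by rewrite lee_fin !mulr_ge0.
under eq_bigr => k _ do rewrite -ge0_integral_sum//.
rewrite -ge0_integral_sum//; last 2 first.
- by move=> k; apply: emeasurable_sum => k' _; exact: mABh.
- by move=> k z _; apply: sume_ge0 => k' _; exact: ABh0.
rewrite le_eqVlt; apply/orP; left; apply/eqP; apply: eq_integral => z _.
under eq_bigr => k _ do rewrite sumEFin -mulr_suml -mulr_sumr sum_indic_partition// mulr1.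
by rewrite sumEFin -mulr_suml sum_indic_partition// mul1r.
Qed.

Lemma has_mean_ge0 d (T : measurableType d) (P : probability T R) (f : T -> R) c :
  measurable_fun setT f -> (forall x, 0 <= f x) ->
  (\int[P]_x (f x)%:E = c%:E)%E -> has_mean P f c.
Proof.
move=> mf f0 fc; split => //; apply/integrableP; split; first exact/measurable_EFinP.
by under eq_integral do rewrite /= ger0_norm//; rewrite fc ltry.
Qed.

Lemma has_mean_norm_le d (T : measurableType d) (P : probability T R) (f : T -> R) a :
  has_mean P f a -> (`|a|%:E <= \int[P]_x `|f x|%:E)%E.
Proof.
move=> fa; have mf := has_mean_measurable fa; have [_ fE] := fa.
rewrite -abse_EFin -fE.
by apply: (@le_abse_integral _ _ _ P setT (EFin \o f)) => //; exact/measurable_EFinP.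
Qed.

(** The measurable sets that are insensitive to the coordinates outside [J] form a sigma-algebra
    containing the generators. *)
Lemma sigma_coord_invariant p (J : set 'I_p) (A : set (p.-tuple R)) :
  sigma_coord J A -> measurable A /\
  forall x y, (forall j, J j -> tnth x j = tnth y j) -> A x -> A y.
Proof.
move: A; apply: smallest_sub.
  split=> [|A [mA invA]|A invA].
  - by split.
  - split=> [|x y xy [_ Ax]]; first exact: measurableD.
    by split => // Ay; apply: Ax; apply: invA Ay => j Jj; rewrite xy.
  - split=> [|x y xy [n _ Anx]]; first by apply: bigcupT_measurable => n; have [] := invA n.
    by exists n => //; have [_ inv] := invA n; exact: inv Anx.
move=> A [j Jj [B mB <-]]; split=> [|x y xy [_ Bx]].
  exact: (measurable_tnth j measurableT mB).
by split => //; rewrite /preimage/= /Defs.coord -xy.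
Qed.

End beta_coefficient.

Section matching_mixing.
Context (R : realType) (p : nat) (d s : R).
Context (s0 : 0 < s) (ds : d ^+ 2 + s ^+ 2 = 1).
Notation Z := (iid_law (std_normal R) p).
Context (I : finType) (e : I -> 'I_p * 'I_p) (e_matching : matching e).
Notation ratio := (matching_ratio d s e).
Local Open Scope ereal_scope.

Lemma matching_edge_unique b b' j :
  j \in [:: (e b).1; (e b).2] -> j \in [:: (e b').1; (e b').2] -> b = b'.
Proof.
move=> jb jb'; apply/eqP; apply: contraT => bb'.
have [_ /(_ _ _ bb')/and4P[h1 h2 h3 h4]] := e_matching.
move: jb jb'; rewrite !inE => /orP[] /eqP ->;
  by rewrite ?(negbTE h1) ?(negbTE h2) ?(negbTE h3) ?(negbTE h4).
Qed.

Lemma integral_matching_elim (P : pred I) (H : p.-tuple R -> \bar R) :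
  measurable_fun setT H -> (forall x, 0 <= H x) ->
  (forall b, P b -> exists2 j, j \in [:: (e b).1; (e b).2] & depends_on (predC1 j) H) ->
  \int[Z]_x (H x * (ratio P x)%:E) = \int[Z]_x H x.
Proof.
move=> mH H0 HP; rewrite /matching_ratio.
under eq_integral do rewrite -big_filter.
move: (filter_all P (index_enum I)) (filter_uniq P (index_enum_uniq I)).
elim: [seq b <- index_enum I | P b] => [_ _|b bs IH].
  by under eq_integral do rewrite big_nil mule1.
move=> /= /andP[Pb Pbs] /andP[bbs ubs].
have [j jb Hj] := HP b Pb.
have [/(_ b) e12 _] := e_matching.
transitivity (\int[Z]_x
   (H x * (\prod_(b' <- bs) edge_ratio d s (e b') x)%:E * (edge_ratio d s (e b) x)%:E)).
  by apply: eq_integral => x _; rewrite big_cons mulrC [in LHS]EFinM muleA.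
rewrite (integral_edge_ratio s0 ds e12 jb); first exact: IH.
- apply: emeasurable_funM => //; apply/measurable_EFinP.
  by apply: measurable_prod => b' _; exact: measurable_edge_ratio.
- by move=> x; rewrite mule_ge0// lee_fin prodr_ge0// => b' _; exact: edge_ratio_ge0.
move=> x y xy; rewrite (Hj x y xy) !big_seq; congr (_ * _%:E).
apply: eq_bigr => b' b'bs.
have jN i : i \in [:: (e b').1; (e b').2] -> predC1 j i.
  by move=> ib'; apply: contraNneq bbs => ij; rewrite -ij in jb;
    rewrite (matching_edge_unique jb ib').
by apply: (@depends_on_edge_ratio _ _ _ _ (predC1 j)) xy; apply: jN;
  rewrite !inE eqxx ?orbT.
Qed.

Lemma integral_matching_ratio (P : pred I) : \int[Z]_x (ratio P x)%:E = 1.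
Proof.
have := @integral_matching_elim P (cst 1) (measurable_cst _) (fun=> lee01).
under eq_integral do rewrite mul1e.
move=> ->; first by rewrite integral_cst//= probability_setT mule1.
by move=> b _; exists (e b).1; rewrite ?inE ?eqxx//.
Qed.

Lemma has_mean_matching_ratio (P : pred I) : has_mean Z (ratio P) 1.
Proof.
apply: has_mean_ge0; first exact: measurable_matching_ratio.
  by move=> x; exact: matching_ratio_ge0.
exact: integral_matching_ratio.
Qed.

Lemma matching_ratio_split (P Q : pred I) z :
  ratio P z = (ratio (predI P Q) z * ratio (predD P Q) z)%R.
Proof. by rewrite /matching_ratio (bigID Q)/=; congr (_ * _)%R; apply: eq_bigl => b; rewrite /= andbC. Qed.

Lemma eq_matching_ratio (P Q : pred I) z : P =1 Q -> ratio P z = ratio Q z.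
Proof. exact: eq_bigl. Qed.

Context (mu : p.-tuple R) (J : pred 'I_p).
Notation F := (gaussian mu (matching_mx d s e)).

Definition shift (z : p.-tuple R) : p.-tuple R := [tuple tnth mu i + tnth z i | i < p]%R.

Lemma measurable_shift : measurable_fun setT shift.
Proof.
apply/measurable_fun_tnthP => i.
rewrite (_ : _ \o _ = fun x : p.-tuple R => tnth mu i + tnth x i)%R.
  by apply: measurable_funD => //; exact: measurable_tnth.
by apply/funext => x /=; rewrite tnth_mktuple.
Qed.

Let measurable_indic_shift (A : set (p.-tuple R)) : measurable A ->
  measurable_fun setT (fun z => \1_A (shift z) : R).
Proof.
move=> mA; apply: measurableT_comp; last exact: measurable_shift.
exact: measurable_indic.
Qed.

Lemma gaussian_matchingE A : measurable A ->
  F A = \int[Z]_z (\1_A (shift z) * ratio xpredT z)%:E.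
Proof.
move=> mA; transitivity (\int[F]_x (\1_A x)%:E); first by rewrite integral_indic// setIT.
rewrite ge0_integral_distribution//; last exact/measurable_EFinP/measurable_indic.
transitivity (\int[Z]_x (\1_A (shift (affine [tuple 0%R | _ < p] (matching_mx d s e) x)))%:E).
  apply: eq_integral => x _ /=; congr (\1_A _)%:E; apply: eq_from_tnth => i.
  by rewrite /shift !tnth_mktuple add0r.
rewrite (integral_affine_matching s0 ds e_matching (f := fun z => (\1_A (shift z))%:E))//.
by apply/measurable_EFinP; exact: measurable_indic_shift.
Qed.

Let inside b := J (e b).1 && J (e b).2.
Let outside b := ~~ J (e b).1 && ~~ J (e b).2.
Definition split_edge b := J (e b).1 != J (e b).2.

Let indic_depends (J' : pred 'I_p) (A : set (p.-tuple R)) :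
  (forall x y, (forall j, J' j -> tnth x j = tnth y j) -> A x -> A y) ->
  depends_on J' (fun z => \1_A (shift z) : R).
Proof.
move=> invA x y xy; rewrite !indicE; congr (nat_of_bool _)%:R.
by apply/idP/idP => /set_mem Ax; apply/mem_set; apply: invA Ax => j Jj;
  rewrite !tnth_mktuple xy.
Qed.

(** An event on one side of the cut sees only the edges inside that side: any other edge has an
    endpoint outside [J'], which can be integrated out. *)
Let integral_indic_side (P : pred I) (J' : pred 'I_p) (A : set (p.-tuple R)) :
  measurable A ->
  (forall x y, (forall j, J' j -> tnth x j = tnth y j) -> A x -> A y) ->
  (forall b, P b = J' (e b).1 && J' (e b).2) ->
  F A = \int[Z]_z (\1_A (shift z) * ratio P z)%:E.
Proof.
move=> mA invA PJ; rewrite gaussian_matchingE//.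
under eq_integral do rewrite (matching_ratio_split xpredT P) mulrA EFinM.
rewrite integral_matching_elim.
- by apply: eq_integral => z _; congr (_ * _)%:E; apply: eq_matching_ratio.
- apply/measurable_EFinP; apply: measurable_funM; first exact: measurable_indic_shift.
  exact: measurable_matching_ratio.
- by move=> z; rewrite lee_fin mulr_ge0// matching_ratio_ge0.
move=> b /= /andP[]; rewrite PJ negb_and => PN _.
have [j jb jN] : exists2 j, j \in [:: (e b).1; (e b).2] & ~~ J' j.
  by case/orP: PN => ?; [exists (e b).1|exists (e b).2] => //; rewrite !inE eqxx ?orbT.
exists j => // x y xy.
have xyJ i : J' i -> tnth x i = tnth y i.
  by move=> Ji; apply: xy => /=; apply: contraNneq jN => <-.
rewrite (indic_depends invA xyJ); congr (_ * _)%:E.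
by apply: (@depends_on_matching_ratio _ _ _ _ _ J') xyJ => b' /=; rewrite PJ.
Qed.

(* Total variation between the law and the product law of the two coordinate
   blocks, before integration: only the edges that [J] splits contribute. *)
Let dependence (z : p.-tuple R) : R :=
  (ratio inside z * ratio outside z * `|ratio split_edge z - 1|)%R.

Let ratio_split3 z :
  ratio xpredT z = (ratio inside z * ratio outside z * ratio split_edge z)%R.
Proof.
rewrite (matching_ratio_split xpredT inside).
rewrite (matching_ratio_split (predD xpredT inside) outside) mulrA.
congr (_ * _ * _)%R; apply: eq_matching_ratio => b; rewrite /= /inside /outside /split_edge;
  by case: (J _); case: (J _).
Qed.

Let base (z : p.-tuple R) : R := (ratio inside z * ratio outside z)%R.

Let baseE z : base z = ratio (predU inside outside) z.
Proof.
rewrite (matching_ratio_split (predU _ _) inside) /base; congr (_ * _)%R;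
  apply: eq_matching_ratio => b; rewrite /= /inside /outside;
  by case: (J _); case: (J _).
Qed.

Let has_mean_base : has_mean Z base 1.
Proof. by apply: eq_has_mean (has_mean_matching_ratio (predU inside outside)) => z; rewrite baseE. Qed.

Let base_ge0 z : (0 <= base z)%R.
Proof. by rewrite mulr_ge0// matching_ratio_ge0. Qed.

Let has_mean_baseM : has_mean Z (fun z => base z * ratio split_edge z)%R 1.
Proof. by apply: eq_has_mean (has_mean_matching_ratio xpredT) => z; rewrite ratio_split3. Qed.

Lemma dependence_ge0 z : (0 <= dependence z)%R.
Proof. by rewrite mulr_ge0 ?base_ge0. Qed.

Lemma measurable_dependence : measurable_fun setT dependence.
Proof.
apply: measurable_funM; first exact: has_mean_measurable has_mean_base.
apply: measurableT_comp => //; apply: measurable_funB => //.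
exact: measurable_matching_ratio.
Qed.

(** Without the split edges the density factorises over the two sides and keeps both marginals, so
    [base] is the density of the product law. The defect is then the integral of [base] times
    [ratio split_edge - 1] over the event. *)
Lemma gaussian_matching_dependence (J1 J2 : set 'I_p) (A B : set (p.-tuple R)) :
  (forall j, J1 j -> J j) -> (forall j, J2 j -> ~~ J j) ->
  sigma_coord J1 A -> sigma_coord J2 B ->
  `|F (A `&` B) - F A * F B| <=
  \int[Z]_z (\1_A (shift z) * \1_B (shift z) * dependence z)%:E.
Proof.
move=> J1J J2J /sigma_coord_invariant[mA invA] /sigma_coord_invariant[mB invB].
have invA' x y : (forall j, J j -> tnth x j = tnth y j) -> A x -> A y.
  by move=> xy; apply: invA => j /J1J; exact: xy.
have invB' x y : (forall j, predC J j -> tnth x j = tnth y j) -> B x -> B y.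
  by move=> xy; apply: invB => j /J2J; exact: xy.
pose w z : R := (\1_A (shift z) * \1_B (shift z))%R.
have mw : measurable_fun setT w by apply: measurable_funM; exact: measurable_indic_shift.
have w01 z : (0 <= w z <= 1)%R.
  by rewrite /w !indicE; case: (_ \in A); case: (_ \in B); rewrite ?mulr0 ?mul0r ?mulr1 ?lexx ?ler01.
have FAB : F A * F B = \int[Z]_z (w z * base z)%:E.
  rewrite (integral_indic_side mA invA' (P := inside))//.
  rewrite (integral_indic_side mB invB' (P := outside))// muleC.
  rewrite -(@integral_indep _ _ _ _ _ J).
  - apply: eq_integral => z _; rewrite -EFinM; congr EFin; rewrite /w /base.
    by rewrite mulrACA (mulrC (\1_B _)) (mulrC (ratio outside z)).
  - apply/measurable_EFinP; apply: measurable_funM; first exact: measurable_indic_shift.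
    exact: measurable_matching_ratio.
  - by move=> z; rewrite lee_fin mulr_ge0// matching_ratio_ge0.
  - move=> x y xy; rewrite (indic_depends invB' xy); congr (_ * _)%:E.
    exact: (@depends_on_matching_ratio _ _ _ _ _ (predC J)) xy.
  - apply/measurable_EFinP; apply: measurable_funM; first exact: measurable_indic_shift.
    exact: measurable_matching_ratio.
  - by move=> z; rewrite lee_fin mulr_ge0// matching_ratio_ge0.
  - move=> x y xy; rewrite (indic_depends invA' xy); congr (_ * _)%:E.
    exact: (@depends_on_matching_ratio _ _ _ _ _ J) xy.
have FI : F (A `&` B) = \int[Z]_z (w z * (base z * ratio split_edge z))%:E.
  rewrite gaussian_matchingE; last exact: measurableI.
  by apply: eq_integral => z _; rewrite ratio_split3 indicI.
have m1 := has_mean_bounded mw w01 base_ge0 has_mean_base.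
have bs0 z : (0 <= base z * ratio split_edge z)%R.
  by rewrite mulr_ge0// matching_ratio_ge0.
have m2 := has_mean_bounded mw w01 bs0 has_mean_baseM.
have [_ E1] := m1; have [_ E2] := m2.
rewrite FAB FI E1 E2 -EFinB abse_EFin.
apply: le_trans (has_mean_norm_le (has_meanB m2 m1)) _.
rewrite le_eqVlt; apply/orP; left; apply/eqP; apply: eq_integral => z _; congr EFin.
have /andP[wz _] := w01 z.
rewrite -mulrBr normrM (ger0_norm wz) -{2}[base z]mulr1 -mulrBr normrM.
by rewrite (ger0_norm (base_ge0 z)).
Qed.

Lemma has_mean_dependence : has_mean Z dependence (fine (\int[Z]_z (dependence z)%:E)).
Proof.
have mdep := measurable_dependence.
have [gi _] := has_meanD has_mean_baseM has_mean_base.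
have di : Z.-integrable setT (EFin \o dependence).
  apply: (le_integrable measurableT _ _ gi); first exact/measurable_EFinP.
  move=> z _ /=; rewrite lee_fin !ger0_norm ?dependence_ge0//; last first.
    by rewrite addr_ge0 ?mulr_ge0 ?matching_ratio_ge0.
  rewrite /dependence -/(base z) -[X in (_ <= _ + X)%R]mulr1 -mulrDr ler_wpM2l//.
  rewrite (le_trans (ler_normB _ _))// normr1 ger0_norm// matching_ratio_ge0//.
by split => //; rewrite fineK//; exact: integrable_fin_num.
Qed.

Let D := fine (\int[Z]_z (dependence z)%:E).

Lemma dependence_le0 : (forall b, ~~ split_edge b) -> (D <= 0)%R.
Proof.
move=> noQ; apply: has_mean_le has_mean_dependence (has_mean_cst Z 0) => z.
rewrite /dependence /matching_ratio [X in (`|X - 1|)%R]big_pred0 ?subrr ?normr0 ?mulr0//.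
by move=> b; exact/negbTE.
Qed.

(** The endpoints of the only split edge are invisible to [base], so under [base] its ratio has mean
    1 and second moment [s ^- 2]; [ler_amgm] passes from this variance to the absolute deviation. *)
Lemma dependence_le (eps : R) : (0 < eps)%R ->
  (forall b b', split_edge b -> split_edge b' -> b = b') ->
  (D <= eps + (s ^- 2 - 1) / (4 * eps))%R.
Proof.
move=> eps0 uniqQ.
have s2 : (1 <= s ^- 2)%R.
  by rewrite invf_ge1 ?exprn_gt0// -ds lerDr sqr_ge0.
have [b Qb|noQ] := pickP split_edge; last first.
  apply: (@le_trans _ _ 0%R); first by apply: dependence_le0 => b; rewrite noQ.
  by rewrite addr_ge0 ?(ltW eps0)// divr_ge0 ?subr_ge0// mulr_ge0// ltW.
have QE z : ratio split_edge z = edge_ratio d s (e b) z.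
  rewrite /matching_ratio (big_pred1 b)// => b'; apply/idP/eqP => [Qb'|->//].
  exact: uniqQ.
have base_indep j : j \in [:: (e b).1; (e b).2] -> depends_on (predC1 j) base.
  move=> jb x y xy; rewrite !baseE.
  apply: (@depends_on_matching_ratio _ _ _ _ _ (predC1 j)) xy => b' /= b'io.
  have bb' : b != b'.
    apply: contraTneq b'io => <-; move: Qb; rewrite /split_edge /inside /outside.
    by case: (J _); case: (J _).
  by apply/andP; split; apply: contraNneq bb' => bj; apply/eqP;
    apply: matching_edge_unique jb _; rewrite -bj !inE eqxx ?orbT.
have [/(_ b) e12 _] := e_matching.
have hsq : has_mean Z (fun z => base z * edge_ratio d s (e b) z ^+ 2)%R (s ^- 2).
  apply: has_mean_ge0.
  - apply: measurable_funM; first exact: has_mean_measurable has_mean_base.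
    by apply: measurable_funX; exact: measurable_edge_ratio.
  - by move=> z; rewrite mulr_ge0 ?sqr_ge0.
  under eq_integral do rewrite EFinM.
  rewrite (integral_edge_ratio_sqr s0 ds e12 (K := fun z => (base z)%:E)).
  - by have [_ ->] := has_mean_base; rewrite mul1e.
  - by apply/measurable_EFinP; exact: has_mean_measurable has_mean_base.
  - by move=> z; rewrite lee_fin.
  - by move=> x y xy; congr EFin; apply: base_indep xy; rewrite !inE eqxx.
  - by move=> x y xy; congr EFin; apply: base_indep xy; rewrite !inE eqxx orbT.
have h2 := has_mean_baseM.
have := has_meanD (has_meanZ eps has_mean_base)
  (has_meanZ (4 * eps)^-1 (has_meanD (has_meanB hsq (has_meanZ 2 h2)) has_mean_base)).
rewrite mulr1 (_ : s ^- 2 - 2 * 1 + 1 = s ^- 2 - 1)%R; last by ring.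
rewrite (mulrC (4 * eps)^-1%R); apply: has_mean_le has_mean_dependence => z.
rewrite /dependence -/(base z) QE; set t := edge_ratio _ _ _ _.
rewrite [leRHS](_ : _ = base z * (eps + (t - 1) ^+ 2 / (4 * eps)))%R; last first.
  by field; rewrite gt_eqF.
rewrite ler_wpM2l// ler_norml; apply/andP; split.
  (* The lower bound is the same inequality, reflected about 1. *)
  have := ler_amgm (2 - t) eps0; rewrite (_ : 2 - t - 1 = - (t - 1))%R; last by ring.
  by rewrite sqrrN; lra.
by have := ler_amgm t eps0; lra.
Qed.

Lemma beta_coef_matching (J1 J2 : set 'I_p) :
  (forall j, J1 j -> J j) -> (forall j, J2 j -> ~~ J j) ->
  beta_coef F (sigma_coord J1) (sigma_coord J2) <= (2^-1 * D)%:E.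
Proof.
move=> J1J J2J; apply: (@beta_coef_le _ _ _ _ _ _ _ _ Z shift dependence).
- exact: measurable_shift.
- by move=> A /sigma_coord_invariant[].
- by move=> A /sigma_coord_invariant[].
- exact: dependence_ge0.
- exact: has_mean_dependence.
- by move=> A B JA JB; exact: (gaussian_matching_dependence J1J J2J).
Qed.

End matching_mixing.

(** In [zeta] the j-th term of the sequence is coordinate [s j], so the position of coordinate [x]
    is given by the inverse permutation. *)
Lemma perm_of_enumeration n (l : seq 'I_n) : uniq l -> (forall x, x \in l) ->
  exists sg : 'S_n, forall x, (sg^-1)%g x = index x l :> nat.
Proof.
move=> ul lx.
have lt_index x : (index x l < n)%N.
  by rewrite (leq_trans (n := size l)) ?index_mem// -[leqRHS]card_ord cardE;
    apply: uniq_leq_size => // y _; rewrite mem_enum.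
have inj : injective (fun x => Ordinal (lt_index x)).
  by move=> x y /(congr1 val)/= xy; rewrite -(nth_index x (lx x)) xy nth_index.
by exists (perm inj)^-1%g => x; rewrite invgK permE.
Qed.

Section matching_permutation.
Context (p : nat) (I : finType) (e : I -> 'I_p * 'I_p) (e_matching : matching e).

Let endpoints (bs : seq I) := flatten [seq [:: (e b).1; (e b).2] | b <- bs].

Let endpointsP bs j :
  reflect (exists2 b, b \in bs & j \in [:: (e b).1; (e b).2]) (j \in endpoints bs).
Proof. exact: flatten_mapP. Qed.

Let uniq_endpoints bs : uniq bs -> uniq (endpoints bs).
Proof.
elim: bs => //= b bs IH /andP[bbs ubs]; have [/(_ b) e12 _] := e_matching.
have N j : j \in [:: (e b).1; (e b).2] -> j \notin endpoints bs.
  move=> jb; apply/negP => /endpointsP[b' b'bs jb'].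
  by rewrite (matching_edge_unique e_matching jb jb') b'bs in bbs.
by rewrite inE negb_or e12 !N ?IH// !inE eqxx ?orbT.
Qed.

Let index_endpoints bs b : b \in bs ->
  (index (e b).1 (endpoints bs) = (index b bs).*2) /\
  (index (e b).2 (endpoints bs) = (index b bs).*2.+1).
Proof.
elim: bs => //= b' bs IH; rewrite inE eq_sym.
have [<-|b'b /= bbs] := eqVneq b' b.
  by have [/(_ b') /negbTE e12 _] := e_matching; rewrite !eqxx e12.
have [_ /(_ _ _ b'b)/and4P[/negbTE-> /negbTE-> /negbTE-> /negbTE->]] := e_matching.
by have [-> ->] := IH bbs.
Qed.

(* Listing the two ends of each edge next to each other makes the sequence
   1-dependent. *)
Lemma matching_permutation : exists sg : 'S_p, forall b, exists k : nat,
  (sg^-1)%g (e b).1 = k.*2 :> nat /\ (sg^-1)%g (e b).2 = k.*2.+1 :> nat.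
Proof.
pose E := endpoints (enum I).
have [|x|sg sgE] := @perm_of_enumeration p (E ++ [seq x <- enum 'I_p | x \notin E]).
- rewrite cat_uniq uniq_endpoints ?enum_uniq//= filter_uniq ?enum_uniq// andbT.
  by apply/hasPn => x; rewrite mem_filter => /andP[].
- by rewrite mem_cat mem_filter mem_enum andbT orbN.
exists sg => b; exists (index b (enum I)); have bI := mem_enum I b.
have [i1 i2] := index_endpoints bI.
have E1 : (e b).1 \in E by apply/endpointsP; exists b; rewrite ?inE ?eqxx.
have E2 : (e b).2 \in E by apply/endpointsP; exists b; rewrite ?inE ?eqxx ?orbT.
by rewrite !sgE !index_cat E1 E2.
Qed.

End matching_permutation.

Section matching_assumptions.
Context (R : realType) (p : nat) (d s : R).
Context (s0 : 0 < s) (ds : d ^+ 2 + s ^+ 2 = 1).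

Lemma zeta_matching_le (I : finType) (e : I -> 'I_p * 'I_p) (mu : p.-tuple R)
    (sg : 'S_p) (C gamma eps : R) (h : nat) :
  matching e ->
  (forall b, exists k : nat,
    (sg^-1)%g (e b).1 = k.*2 :> nat /\ (sg^-1)%g (e b).2 = k.*2.+1 :> nat) ->
  0 < eps -> 0 <= C -> 0 <= gamma ->
  2^-1 * (eps + (s ^- 2 - 1) / (4 * eps)) <= C * gamma -> (1 <= h)%N ->
  (zeta (gaussian mu (matching_mx d s e)) sg h <= (C * gamma ^+ h)%:E)%E.
Proof.
move=> e_matching sgP eps0 C0 gamma0 Cgamma h1.
apply: ge_ereal_sup => _ [m /= /andP[m1 mph] <-].
(* Edges occupy the positions 2k and 2k + 1, so an even cut splits none. If [h > 1] the gap between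
   the two blocks leaves room to move an odd cut up by one; only [h = 1] with odd [m] splits an
   edge, and then exactly one can be split. *)
pose cut := if odd m && (1 < h)%N then m.+1 else m.
pose J : pred 'I_p := fun x => ((sg^-1)%g x < cut)%N.
have J1J j : [set sg j | j in [set j : 'I_p | (j < m)%N]] j -> J j.
  move=> [i /= im <-]; rewrite /J permK /cut; case: ifP => // _; exact: leqW.
have J2J j : [set sg j | j in [set j : 'I_p | (m + h <= j.+1)%N]] j -> ~~ J j.
  by move=> [i /= im <-]; rewrite /J permK -leqNgt /cut; case: ifP; lia.
apply: le_trans (beta_coef_matching s0 ds e_matching mu J1J J2J) _.
have split0 : ~~ odd cut -> forall b, ~~ split_edge e J b.
  move=> cut_even b; rewrite negbK /J; have [k [-> ->]] := sgP b; apply/eqP.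
  by move: cut_even; lia.
have [cut_odd|cut_even] := boolP (odd cut); last first.
  rewrite lee_fin (@le_trans _ _ 0)// ?mulr_ge0 ?exprn_ge0//.
  by rewrite pmulr_rle0 ?invr_gt0//; apply: dependence_le0 => //; exact: split0.
have -> : h = 1%N by move: cut_odd; rewrite /cut; case: ifP => /=; lia.
rewrite expr1 lee_fin; apply: le_trans Cgamma; rewrite ler_pM2l ?invr_gt0//.
apply: dependence_le => // b b'; rewrite /split_edge /J.
have [k [k1 k2]] := sgP b; have [k' [k1' k2']] := sgP b'; rewrite k1 k2 k1' k2' => kb kb'.
have kk' : k = k' by lia.
have eb : (e b).1 = (e b').1.
  by apply: (@perm_inj _ sg^-1%g); apply: val_inj; rewrite /= k1 k1' kk'.
by apply: (matching_edge_unique e_matching (j := (e b).1)); rewrite ?eb !inE eqxx.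
Qed.

(** The empty matching gives the identity, so the mixing bound also covers the unperturbed law. *)
Lemma matching_mx_void (e : void -> 'I_p * 'I_p) : matching_mx d s e = 1%:M.
Proof. by apply/matrixP => i j; rewrite !mxE; case: pickP => [[]|_]. Qed.

Lemma mulmx1_tr : (1%:M : 'M[R]_p) *m 1%:M^T = 1%:M.
Proof. by rewrite trmx1 mulmx1. Qed.

Context (I : finType) (e : I -> 'I_p * 'I_p) (e_matching : matching e).

Lemma edge_of_diag i : edge_of e i i = false.
Proof.
apply/existsP => -[b /eqP eb]; have [/(_ b) + _] := e_matching.
by rewrite eb eqxx.
Qed.

(** Leaving each matrix free to be perturbed or not treats the null pair and both kinds of
    alternatives at once, with one common permutation. *)
Lemma matching_assumptions (tau rho0 C gamma eps : R) (mu1 mu2 : p.-tuple R)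
    (A1 A2 : 'M[R]_p) :
  A1 = matching_mx d s e \/ A1 = 1%:M -> A2 = matching_mx d s e \/ A2 = 1%:M ->
  0 < tau < 1 -> 0 < eps -> 0 <= C -> 0 <= gamma ->
  `|d| <= 1 -> 2 * `|d| < 1 - rho0 ->
  2^-1 * (eps + (s ^- 2 - 1) / (4 * eps)) <= C * gamma ->
  assumptions245 tau rho0 C gamma (gaussian mu1 A1) (gaussian mu2 A2).
Proof.
move=> hA1 hA2 htau eps0 C0 gamma0 d1 drho Cgamma.
have diag A : A = matching_mx d s e \/ A = 1%:M -> forall i, (A *m A^T) i i = 1.
  move=> [->|->] i; last by rewrite mulmx1_tr mxE eqxx.
  by rewrite matching_mx_cov// eqxx !edge_of_diag mulr0 addr0.
have offdiag A : A = matching_mx d s e \/ A = 1%:M ->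
    forall i j, i != j -> `|(A *m A^T) i j| <= `|d|.
  move=> [->|->] i j /negbTE ij; last by rewrite mulmx1_tr mxE ij normr0.
  rewrite matching_mx_cov// ij add0r; case: (_ || _); rewrite ?mulr1// mulr0 normr0//.
have d01 : 0 <= `|d| <= 1 by rewrite normr_ge0.
split.
- by move=> F [->|->]; apply: gaussian_assumption2 => //; exact: diag.
- by move=> F [->|->]; [exact: (gaussian_assumption4 _ d01 (diag _ hA1) (offdiag _ hA1))|
    exact: (gaussian_assumption4 _ d01 (diag _ hA2) (offdiag _ hA2))].
have [sg sgP] := matching_permutation e_matching.
exists sg => h /andP[h1 _].
have zetaA mu A : A = matching_mx d s e \/ A = 1%:M ->
    (zeta (gaussian mu A) sg h <= (C * gamma ^+ h)%:E)%E.
  move=> [->|->]; first exact: zeta_matching_le Cgamma h1.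
  rewrite -(matching_mx_void (of_void _)).
  by apply: zeta_matching_le Cgamma h1.
by rewrite ge_max !zetaA.
Qed.

End matching_assumptions.

(** * Least favourable families and the power bound *)

Section edge_family.
Context (R : realType) (p m g : nat) (v : 'I_m * bool * 'I_g -> 'I_p).
Context (v_inj : injective v) (g_gt0 : (0 < g)%N).
Notation choice := {ffun 'I_m -> 'I_g * 'I_g}.

(** Each group has two halves of [g] coordinates, labelled by the boolean, and its edge runs from
    one half to the other. A first end thus never equals a second end, even across two different
    choices. *)
Definition family_edge (M : choice) (b : 'I_m) : 'I_p * 'I_p :=
  (v (b, false, (M b).1), v (b, true, (M b).2)).

Lemma family_edge_disjoint M M' b b' : b != b' ->
  disjoint_edges (family_edge M b) (family_edge M' b').
Proof.
by move=> bb'; rewrite /disjoint_edges /family_edge /= !(inj_eq v_inj) !xpair_eqE (negbTE bb').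
Qed.

Lemma family_edge_neq M M' b : (family_edge M b).1 != (family_edge M' b).2.
Proof. by rewrite /family_edge /= (inj_eq v_inj) !xpair_eqE andbF. Qed.

Lemma family_matching M : matching (family_edge M).
Proof. by split=> [b|b b']; [exact: family_edge_neq|exact: family_edge_disjoint]. Qed.

Lemma eq_family_edge M M' b : (family_edge M b == family_edge M' b) = (M b == M' b).
Proof.
rewrite /family_edge xpair_eqE !(inj_eq v_inj) !xpair_eqE !eqxx /=.
by case: (M b) => ? ?; case: (M' b) => ? ?; rewrite xpair_eqE.
Qed.

Context (d s : R) (s0 : 0 < s) (ds : d ^+ 2 + s ^+ 2 = 1).
Context (mu : p.-tuple R) (n : nat).
Notation G := (gaussian mu 1%:M).

Let f M (x : p.-tuple R) : R :=
  matching_ratio d s (family_edge M) xpredT [tuple tnth x i - tnth mu i | i < p].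

Let f_density M : has_density (gaussian mu (matching_mx d s (family_edge M))) G (f M).
Proof. exact: (has_density_gaussian_matching s0 ds (family_matching M)). Qed.

Let L M (x : n.-tuple (p.-tuple R)) : R := \prod_(i < n) f M (tnth x i).

Let L_density M := has_density_iid_law n (f_density M).

Let f_ge0 M x : 0 <= f M x. Proof. by have [_ + _] := f_density M; exact. Qed.

Let measurable_f M : measurable_fun setT (f M).
Proof. by have [] := f_density M. Qed.

Let tnth_center (z : p.-tuple R) :
  [tuple tnth (affine mu 1%:M z) i - tnth mu i | i < p] = z.
Proof.
apply: eq_from_tnth => i; rewrite !tnth_mktuple.
rewrite (bigD1 i)//= mxE eqxx mul1r big1 ?addr0 1?addrC ?addKr// => j ji.
by rewrite mxE eq_sym (negbTE ji) mul0r.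
Qed.

Let overlap (M M' : choice) : R := \prod_(b < m) (if M b == M' b then s ^- 2 else 1).

Let integral_fM M M' : (\int[G]_x (f M x * f M' x)%:E = (overlap M M')%:E)%E.
Proof.
rewrite ge0_integral_distribution//; last 2 first.
- by apply/measurable_EFinP; exact: measurable_funM.
- by move=> x; rewrite lee_fin mulr_ge0.
rewrite /overlap; under eq_bigr do rewrite -eq_family_edge.
rewrite -(integral_matching_ratioM s0 ds).
- by apply: eq_integral => z _; rewrite /= /f tnth_center.
- by move=> b; rewrite !family_edge_neq/= eq_sym family_edge_neq.
- by move=> b b' bb'; rewrite !family_edge_disjoint.
Qed.

Let has_mean_LM M M' :
  has_mean (iid_law G n) (fun x => L M x * L M' x) (overlap M M' ^+ n).
Proof.
have mff : measurable_fun setT (fun x => f M x * f M' x) by exact: measurable_funM.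
have ff0 x : 0 <= f M x * f M' x by rewrite mulr_ge0.
have := integral_iid_law_prod n mff ff0 (integral_fM M M').
under eq_integral do rewrite big_split/=.
apply: has_mean_ge0.
- by apply: measurable_funM; exact: measurable_prod_tnth.
- by move=> x; rewrite mulr_ge0 ?prodr_ge0.
Qed.

Let has_mean_L M : has_mean (iid_law G n) (L M) 1.
Proof.
have [mL L0 Ld] := L_density M; apply: has_mean_ge0 => //.
have := Ld (cst 1%E) (measurable_cst _) (fun=> lee01).
under [X in _ = X -> _]eq_integral do rewrite mul1e.
by move=> <-; rewrite integral_cst//= probability_setT mule1.
Qed.

(** The sum over [M'] distributes into a product over groups; in each group one of the [g ^+ 2]
    candidates agrees with [M] and contributes the second moment, and the others contribute 1. *)
Let sum_overlap : \sum_M \sum_M' overlap M M' ^+ n =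
  (1 + (s ^- 2 ^+ n - 1) / g%:R ^+ 2) ^+ m * #|{: choice}|%:R ^+ 2.
Proof.
have gn0 : g%:R ^+ 2 != 0 :> R by rewrite expf_neq0// pnatr_eq0 -lt0n.
have inner M : \sum_M' overlap M M' ^+ n = (g%:R ^+ 2 - 1 + s ^- 2 ^+ n) ^+ m.
  transitivity (\sum_(M' : choice) \prod_(b < m) (if M b == M' b then s ^- 2 ^+ n else 1)).
    apply: eq_bigr => M' _; rewrite /overlap -prodrXl; apply: eq_bigr => b _.
    by case: ifP; rewrite ?expr1n.
  rewrite -(bigA_distr_bigA (fun b x => if M b == x then s ^- 2 ^+ n else 1)).
  transitivity (\prod_(b < m) (g%:R ^+ 2 - 1 + s ^- 2 ^+ n)); last first.
    by rewrite prodr_const card_ord.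
  apply: eq_bigr => b _.
  rewrite (bigD1 (M b))//= eqxx addrC; congr (_ + _).
  under eq_bigr => x /negbTE xM do rewrite eq_sym xM.
  rewrite sumr_const (_ : #|_| = (g * g).-1)%N; last first.
    by rewrite -[LHS]/(#|predC1 (M b)|) cardC1 card_prod card_ord.
  by rewrite -subn1 natrB ?muln_gt0 ?g_gt0// natrM expr2.
under eq_bigr do rewrite inner.
rewrite sumr_const -[LHS]mulr_natr [X in _ = _ * X]expr2 [in RHS]mulrA.
congr (_ * _)%R.
rewrite card_ffun card_prod !card_ord natrX -exprMn; congr (_ ^+ m).
by rewrite natrM -expr2 mulrDl divfK//; ring.
Qed.

Lemma family_test_bound (w : n.-tuple (p.-tuple R) -> R) (alpha eps : R) :
  measurable_fun setT w -> (forall x, 0 <= w x <= 1) ->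
  (\int[iid_law G n]_x (w x)%:E <= alpha%:E)%E -> 0 < eps ->
  exists M, (\int[iid_law (gaussian mu (matching_mx d s (family_edge M))) n]_x (w x)%:E <=
    (alpha + eps + ((1 + (s ^- 2 ^+ n - 1) / g%:R ^+ 2) ^+ m - 1) / (4 * eps))%:E)%E.
Proof.
move=> mw w01 walpha eps0.
have card_gt0 : (0 < #|{: choice}|)%N.
  by rewrite card_ffun card_prod !card_ord expn_gt0 muln_gt0 g_gt0.
have LL0 M x : 0 <= L M x by rewrite prodr_ge0.
have sum_le := lexx (\sum_M \sum_M' overlap M M' ^+ n); rewrite [leRHS]sum_overlap in sum_le.
have [M hM] := mixture_test_bound card_gt0 LL0 has_mean_L has_mean_LM
  sum_le mw w01 walpha eps0.
exists M; have [_ _ ->] := L_density M.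
- by apply: le_trans hM; rewrite le_eqVlt; apply/orP; left; apply/eqP; apply: eq_integral.
- exact/measurable_EFinP.
- by move=> x; rewrite lee_fin; have /andP[] := w01 x.
Qed.

End edge_family.

(** * Reduction of a two-sample test to one sample *)

Section two_samples.
Context d1 d2 (T1 : measurableType d1) (T2 : measurableType d2) (R : realType).
Context (Q1 : probability T1 R) (Q2 : probability T2 R).
Local Open Scope ereal_scope.

(** The rejection probability given the first sample. It is a randomised test, which is why the
    one-sample bounds are stated for functions with values in [0, 1]. *)
Definition xpower (Q2' : probability T2 R) (W : set (T1 * T2)) (x : T1) : R :=
  fine (Q2' (xsection W x)).

Definition ypower (Q1' : probability T1 R) (W : set (T1 * T2)) (y : T2) : R :=
  fine (Q1' (ysection W y)).

Context (W : set (T1 * T2)) (mW : measurable W).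

Lemma measurable_xpower : measurable_fun setT (xpower Q2 W).
Proof.
apply/measurable_EFinP; apply: eq_measurable_fun (measurable_fun_xsection Q2 mW) => x _ /=.
by rewrite fineK// fin_num_measure//; exact: measurable_xsection.
Qed.

Lemma measurable_ypower : measurable_fun setT (ypower Q1 W).
Proof.
apply/measurable_EFinP; apply: eq_measurable_fun (measurable_fun_ysection Q1 mW) => x _ /=.
by rewrite fineK// fin_num_measure//; exact: measurable_ysection.
Qed.

Lemma xpower_itv x : (0 <= xpower Q2 W x <= 1)%R.
Proof.
have mx : measurable (xsection W x) by exact: measurable_xsection.
by rewrite /xpower fine_ge0//= -lee_fin fineK ?probability_le1// fin_num_measure.
Qed.

Lemma ypower_itv y : (0 <= ypower Q1 W y <= 1)%R.
Proof.
have my : measurable (ysection W y) by exact: measurable_ysection.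
by rewrite /ypower fine_ge0//= -lee_fin fineK ?probability_le1// fin_num_measure.
Qed.

Lemma product_xpower : (Q1 \x Q2) W = \int[Q1]_x (xpower Q2 W x)%:E.
Proof.
apply: eq_integral => x _ /=; rewrite fineK// fin_num_measure//.
exact: measurable_xsection.
Qed.

Lemma product_ypower : (Q1 \x Q2) W = \int[Q2]_y (ypower Q1 W y)%:E.
Proof.
transitivity (\int[Q1]_x fubini_F Q2 (EFin \o (\1_W : _ -> R)) x).
  by rewrite -indic_fubini_tonelli1// integral_indic// setIT.
rewrite indic_fubini_tonelli//; apply: eq_integral => y _.
rewrite indic_fubini_tonelli_GE//= fineK// fin_num_measure//.
exact: measurable_ysection.
Qed.

End two_samples.

Section sparse_alternatives.
Context (R : realType) (p n1 n2 : nat).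

(** Sorting the ends of each edge is injective on a matching, because an edge is determined by
    either of its ends. *)
Lemma card_edges (I : finType) (e : I -> 'I_p * 'I_p) : matching e ->
  #|[set ij : 'I_p * 'I_p | (ij.1 <= ij.2)%N &&
      (edge_of e ij.1 ij.2 || edge_of e ij.2 ij.1)]%SET| = #|I|.
Proof.
move=> em; pose srt (u : 'I_p * 'I_p) := if (u.1 <= u.2)%N then u else (u.2, u.1).
have srt_mem u : u.1 \in [:: (srt u).1; (srt u).2].
  by rewrite /srt; case: ifP; rewrite !inE eqxx ?orbT.
have mem_srt u j : j \in [:: (srt u).1; (srt u).2] -> j \in [:: u.1; u.2].
  by rewrite /srt; case: ifP => _ //=; rewrite !inE orbC.
rewrite -(card_imset (f := fun b => srt (e b)) predT).
  apply: eq_card => -[i j]; rewrite inE /=; apply/andP/imsetP => [[ij]|[b _ eb]].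
    move=> /orP[]/existsP[b /eqP eb]; exists b => //; rewrite eb /srt/= ?ij//.
    case: ifP => // ji; have ij' : i = j by apply: val_inj; apply/eqP; rewrite eqn_leq ij.
    by rewrite ij'.
  have [le12|lt21] := leqP (e b).1 (e b).2.
    move: eb; rewrite /srt le12; case E : (e b) le12 => [x y] /= xy [-> ->].
    by split=> //; apply/orP; left; apply/existsP; exists b; rewrite E.
  move: eb; rewrite /srt leqNgt lt21; case E : (e b) lt21 => [x y] /= xy [-> ->].
  by split; [exact: ltnW|apply/orP; right; apply/existsP; exists b; rewrite E].
move=> b b' bb'; apply: (matching_edge_unique em (j := (e b).1)).
  by rewrite inE eqxx.
by apply: mem_srt; rewrite -bb'.
Qed.

Lemma matching_sparse_faint (I : finType) (e : I -> 'I_p * 'I_p) (beta c0 : R)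
    (Sigma1 Sigma2 : 'M[R]_p) :
  matching e -> #|I| = Num.truncn ((nb_cov p)%:R `^ (1 - beta)) -> 0 < c0 ->
  let delta := Num.sqrt (2 * c0 * ln (nb_cov p)%:R / eff_size R n1 n2) in
  0 < delta ->
  (forall i j, Sigma1 i j - Sigma2 i j =
    delta * (edge_of e i j || edge_of e j i)%:R) ->
  sparse_faint n1 n2 beta c0 Sigma1 Sigma2.
Proof.
move=> em cardI c0_gt0 delta delta0 SE; split.
  rewrite -cardI -(card_edges em); apply: eq_card => ij; rewrite !inE SE.
  by case: (_ || _); rewrite ?mulr1 ?mulr0 ?eqxx ?(gt_eqF delta0).
move=> i j ij; rewrite SE; case: (_ || _); last by rewrite mulr0 eqxx.
by move=> _; exists c0; rewrite mulr1.
Qed.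

End sparse_alternatives.

Lemma product_card_injection (m g p : nat) : (m * 2 * g <= p)%N ->
  exists v : 'I_m * bool * 'I_g -> 'I_p, injective v.
Proof.
move=> mgp; have card : (#|{: 'I_m * bool * 'I_g}| <= p)%N.
  by rewrite !card_prod !card_ord card_bool.
by exists (widen_ord card \o enum_rank) => x y /(congr1 val)/= /val_inj/enum_rank_inj.
Qed.

(* [side] tells which sample is perturbed; the sign of the covariance is then
   chosen so that [Sigma1 - Sigma2] has nonnegative entries. *)
Section power_bound.
Context (R : realType) (p n1 n2 : nat) (tau rho0 C gamma alpha beta c0 omega : R).
Context (mu1 mu2 : p.-tuple R).

Let delta := Num.sqrt (2 * c0 * ln (nb_cov p)%:R / eff_size R n1 n2).

(** The bound at fixed dimension and sample sizes: [eps1] is the parameter of [ler_amgm] in the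
    mixing coefficient, [eps2] its parameter in the test bound. *)
Lemma maximin_power_le (side : bool) (m g : nat) (eps1 eps2 : R) :
  let ns := if side then n1 else n2 in
  0 < tau < 1 -> 0 <= C -> 0 <= gamma -> 0 < c0 ->
  m = Num.truncn ((nb_cov p)%:R `^ (1 - beta)) -> (0 < g)%N -> (m * 2 * g <= p)%N ->
  0 < delta -> delta < 1 -> 2 * delta < 1 - rho0 ->
  0 < eps1 -> 2^-1 * (eps1 + ((1 - delta ^+ 2)^-1 - 1) / (4 * eps1)) <= C * gamma ->
  0 < eps2 ->
  alpha + eps2 +
    ((1 + ((1 - delta ^+ 2) ^- ns - 1) / g%:R ^+ 2) ^+ m - 1) / (4 * eps2) <= 1 - omega ->
  (maximin_power n1 n2 tau rho0 C gamma alpha mu1 mu2 beta c0 <= (1 - omega)%:E)%E.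
Proof.
move=> ns htau C0 gamma0 c00 mE g0 mgp delta0 delta1 hrho0 eps1_0 Cgamma eps2_0 bound.
have [v v_inj] := product_card_injection mgp.
pose d := if side then delta else - delta.
have d2 : d ^+ 2 = delta ^+ 2 by rewrite /d; case: side {ns bound d}; rewrite ?sqrrN.
have dn : `|d| = delta.
  by rewrite /d; case: side {ns bound d d2}; rewrite ?normrN gtr0_norm.
have s2_gt0 : 0 < 1 - delta ^+ 2 by rewrite subr_gt0 exprn_ilt1// ltW.
pose s := Num.sqrt (1 - delta ^+ 2).
have s0 : 0 < s by rewrite sqrtr_gt0.
have s2 : s ^+ 2 = 1 - delta ^+ 2 by rewrite sqr_sqrtr// ltW.
have ds : d ^+ 2 + s ^+ 2 = 1 by rewrite d2 s2 addrC subrK.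
have ass M A1 A2 :
    A1 = matching_mx d s (family_edge v M) \/ A1 = 1%:M ->
    A2 = matching_mx d s (family_edge v M) \/ A2 = 1%:M ->
    assumptions245 tau rho0 C gamma (gaussian mu1 A1) (gaussian mu2 A2).
  move=> hA1 hA2; apply: (matching_assumptions s0 ds (family_matching v_inj M)
    mu1 mu2 hA1 hA2 htau eps1_0 C0 gamma0); rewrite ?dn ?s2//; exact: ltW.
(* An arbitrary choice: both null covariances are the identity, and [ass] only needs some matching
   by which to order the coordinates. *)
have M0 : {ffun 'I_m -> 'I_g * 'I_g} by exact: [ffun=> (Ordinal g0, Ordinal g0)].
apply: ge_ereal_sup => _ [W Wlevel <-].
have mW : measurable [set x | W x].
  rewrite -[X in measurable X]setTI.
  exact: (measurable_funP W measurableT [set true]).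
have null : (reject_prob (gaussian mu1 1%:M) (gaussian mu2 1%:M) W <= alpha%:E)%E.
  apply: Wlevel (ass M0 _ _ (or_intror erefl) (or_intror erefl)).
  - by have := is_normal_gaussian mu1 1%:M; rewrite mulmx1_tr; exact.
  - by have := is_normal_gaussian mu2 1%:M; rewrite mulmx1_tr; exact.
suff [M [A1 [A2 [hA1 hA2 SE le]]]] : exists M A1 A2,
    [/\ A1 = matching_mx d s (family_edge v M) \/ A1 = 1%:M,
        A2 = matching_mx d s (family_edge v M) \/ A2 = 1%:M,
        forall i j, (A1 *m A1^T) i j - (A2 *m A2^T) i j = delta *
          (edge_of (family_edge v M) i j || edge_of (family_edge v M) j i)%:R &
        (reject_prob (gaussian mu1 A1) (gaussian mu2 A2) W <= (1 - omega)%:E)%E].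
  apply: le_trans le; apply: ereal_inf_lbound.
  exists (A1 *m A1^T, A2 *m A2^T), (gaussian mu1 A1), (gaussian mu2 A2); split => //.
  - split=> /=.
      apply: (matching_sparse_faint (family_matching v_inj M)) => //.
      by rewrite card_ord.
    exists (gaussian mu1 A1), (gaussian mu2 A2); split.
    + exact: is_normal_gaussian.
    + exact: is_normal_gaussian.
    + exact: ass hA1 hA2.
  - exact: is_normal_gaussian.
  - exact: is_normal_gaussian.
(* The unperturbed sample is integrated out: the second one if [side] holds, the first one
   otherwise. *)
move: null bound; rewrite /reject_prob -{1}s2 /ns; case: side @d @ns d2 dn ds ass => d ns d2 dn ds ass.
- rewrite product_xpower// => null bound.
  have [M hM] := family_test_bound v_inj g0 s0 ds
    (measurable_xpower _ mW) (xpower_itv _ mW) null eps2_0.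
  exists M, (matching_mx d s (family_edge v M)), 1%:M; split; [by left|by right| |].
  + move=> i j; rewrite (matching_mx_cov ds (family_matching v_inj M)) mulmx1_tr.
    by rewrite mxE addrC addKr.
  + rewrite product_xpower//; apply: le_trans hM _.
    by rewrite lee_fin exprVn.
- rewrite product_ypower// => null bound.
  have [M hM] := family_test_bound v_inj g0 s0 ds
    (measurable_ypower _ mW) (ypower_itv _ mW) null eps2_0.
  exists M, 1%:M, (matching_mx d s (family_edge v M)); split; [by right|by left| |].
  + move=> i j; rewrite (matching_mx_cov ds (family_matching v_inj M)) mulmx1_tr.
    by rewrite mxE opprD addNKr mulNr opprK.
  + rewrite product_ypower//; apply: le_trans hM _.
    by rewrite lee_fin exprVn.
Qed.

End power_bound.

(** * Growth rates and the choice of constants *)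

Section growth.
Context (R : realType).
Implicit Types x y : R.

Lemma nb_cov_bounds p : (2 <= p)%N -> (2 <= nb_cov p <= p ^ 2)%N.
Proof.
move=> p2; rewrite /nb_cov -mulnn; apply/andP; split.
  by rewrite leq_divRL//; nia.
by rewrite -ltnS ltn_divLR//; nia.
Qed.

(** The remainder of the division is below [m * 2], hence below [m * 2] times the quotient, which is
    positive. *)
Lemma quotient_ge (p m : nat) : (0 < m)%N -> (4 * m <= p)%N ->
  (p <= 4 * m * (p %/ (m * 2)))%N.
Proof.
move=> m0 m4; have m2 : (0 < m * 2)%N by rewrite muln_gt0 m0.
by have := ltn_ceil p m2; move: (p %/ _)%N => g; nia.
Qed.

(** On this interval 1 / (1 - x) <= 1 + 2 x <= exp(2 x). *)
Lemma inv_pow_le_expR x n : 0 <= x <= 2^-1 -> (1 - x) ^- n <= expR (2 * x * n%:R).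
Proof.
move=> /andP[x0 x1]; have y0 : 0 < 1 - x by lra.
rewrite mulrC expRM_natl -exprVn lerXn2r ?nnegrE ?invr_ge0 ?expR_ge0 ?(ltW y0)//.
rewrite -[(1 - x)^-1]mul1r ler_pdivrMr//.
apply: (@le_trans _ _ ((1 + 2 * x) * (1 - x))); first by nra.
by rewrite ler_pM2r// expR_ge1Dx.
Qed.

Lemma near_powRN_le (P : nat -> R) (a b : R) : 0 < a -> 0 < b ->
  P @ \oo --> +oo -> \forall k \near \oo, P k `^ (- a) <= b.
Proof.
move=> a0 b0 /cvgryPge Poo; near=> k.
have Pk : b^-1 `^ a^-1 <= P k by near: k; exact: Poo.
have c0 : 0 < b^-1 `^ a^-1 by rewrite powR_gt0// invr_gt0.
have Pk0 : 0 < P k by exact: lt_le_trans c0 Pk.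
rewrite powRN -[b]invrK lef_pV2 ?posrE ?invr_gt0 ?powR_gt0//.
have -> : b^-1 = (b^-1 `^ a^-1) `^ a.
  by rewrite -powRrM mulVf ?gt_eqF// powRr1// invr_ge0 ltW.
by rewrite ge0_ler_powR ?nnegrE ?(ltW a0) ?(ltW c0) ?(ltW Pk0).
Unshelve. all: by end_near. Qed.

(** The inequality ln(1 + y) <= y at y = x^a - 1. *)
Lemma ln_le_powR x a : 1 <= x -> 0 < a -> ln x <= a^-1 * x `^ a.
Proof.
move=> x1 a0; have x0 : 0 < x by apply: lt_le_trans x1.
rewrite ler_pdivlMl// -ln_powR.
have xa0 := powR_gt0 a x0; have := @le_ln1Dx R (x `^ a - 1).
by rewrite addrCA subrr addr0 => le_ln; apply: le_trans (le_ln _) _; lra.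
Qed.

(** The larger sample makes up at least half of [n1 + n2]. *)
Lemma eff_size_ge (n1 n2 : nat) : 0 < eff_size R n1 n2 ->
  (minn n1 n2)%:R <= 2 * eff_size R n1 n2.
Proof.
rewrite /eff_size; wlog n12 : n1 n2 / (n1 <= n2)%N.
  by move=> H; case/orP: (leq_total n1 n2) => [|n21]; [exact: H|rewrite minnC mulnC addnC; exact: H].
rewrite (minn_idPl n12); have [->|n2_gt0 _] := posnP n2; first by rewrite muln0 mul0r ltxx.
rewrite mulrA ler_pdivlMr ?ltr0n ?addn_gt0 ?n2_gt0 ?orbT//.
by rewrite -natrM -natrM ler_nat; nia.
Qed.

End growth.

Section large_dimension.
Context (R : realType) (p n1 n2 : nat) (tau rho0 C gamma alpha beta omega : R).
Context (mu1 mu2 : p.-tuple R).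

Let u : R := 3 * beta - 2.
Let c0 : R := u / 16.
(** Half of the available slack: [alpha + eps + eps] equals [1 - omega], one [eps] for the linear
    term of the test bound and one for its chi-squared term. *)
Let eps : R := (1 - omega - alpha) / 2.
Let n : R := eff_size R n1 n2.
Let x : R := 2 * c0 * ln (nb_cov p)%:R / n.
Let P : R := p%:R.

Lemma maximin_power_large :
  0 < tau < 1 -> rho0 < 1 -> 0 < C -> 0 < gamma -> 0 < eps -> 0 < u -> beta < 1 ->
  (2 <= p)%N -> 0 < n ->
  P `^ (- (2 * beta - 1)) <= 4^-1 ->
  x <= 2^-1 -> x < ((1 - rho0) / 2) ^+ 2 -> x <= 2 * (C * gamma) ^+ 2 ->
  P `^ (- u) <= ln (1 + 4 * eps ^+ 2) / 16 ->
  (maximin_power n1 n2 tau rho0 C gamma alpha mu1 mu2 beta c0 <= (1 - omega)%:E)%E.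
Proof.
move=> htau rho1 C0 gamma0 eps0 u0 beta1 p2 n0 Hm x_half x_rho x_mix HV.
have /andP[q2 qp2] := nb_cov_bounds p2.
pose q : R := (nb_cov p)%:R.
have P2 : 2 <= P by rewrite ler_nat.
have P0 : 0 < P by lra.
have P1 : 1 <= P by lra.
have qq2 : 2 <= q by rewrite ler_nat.
have q1 : 1 <= q by lra.
have q0 : 0 < q by lra.
have qP : q <= P ^+ 2 by rewrite /q /P -natrX ler_nat.
have c00 : 0 < c0 by rewrite /c0 divr_gt0.
have lnq0 : 0 < ln q by rewrite ln_gt0//; lra.
have x0 : 0 < x by apply: divr_gt0 => //; do 2 apply: mulr_gt0 => //.
have qpow a : 0 <= a -> q `^ a <= P `^ (2 * a).
  move=> a0; rewrite powRrM (powR_mulrn 2) ?(ltW P0)//.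
  by rewrite ge0_ler_powR ?nnegrE ?exprn_ge0 ?(ltW P0)// ltW.
have [m mE] : exists m, m = Num.truncn (q `^ (1 - beta)) by eexists.
have m_le : m%:R <= P `^ (2 * (1 - beta)).
  apply: le_trans (qpow _ _); last by lra.
  by rewrite mE truncn_le powR_ge0.
have m_gt0 : (0 < m)%N.
  by rewrite mE truncn_gt0 -[leLHS](powRr0 q) ler_powR//; lra.
have m0 : 0 < m%:R :> R by rewrite ltr0n.
have m4 : 4 * m%:R <= P.
  have -> : P = P `^ (2 * (1 - beta)) * P `^ (2 * beta - 1).
    rewrite -powRD; last by rewrite (gt_eqF P0) implybT.
    by rewrite (_ : 2 * (1 - beta) + _ = 1); [rewrite powRr1 ?(ltW P0)|ring].
  move: Hm; rewrite powRN lef_pV2 ?posrE ?powR_gt0// => Hm.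
  rewrite mulrC ler_pM//.
have [g gE] : exists g, g = (p %/ (m * 2))%N by eexists.
have m2 : (0 < m * 2)%N by rewrite muln_gt0 m_gt0.
have m4n : (4 * m <= p)%N by rewrite -(ler_nat R) natrM.
have g_gt0 : (0 < g)%N.
  by rewrite gE divn_gt0// (leq_trans _ m4n)// mulnC leq_mul2r orbT.
have mgp : (m * 2 * g <= p)%N by rewrite gE mulnC leq_trunc_div.
have Pg : P <= 4 * m%:R * g%:R.
  by rewrite -natrM -natrM ler_nat gE quotient_ge.
have g0 : 0 < g%:R :> R by rewrite ltr0n.
pose delta := Num.sqrt x.
have delta2 : delta ^+ 2 = x by rewrite sqr_sqrtr// ltW.
have delta0 : 0 < delta by rewrite sqrtr_gt0.
pose side := (n1 <= n2)%N.
pose ns := if side then n1 else n2.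
have nsE : ns = minn n1 n2.
  by rewrite /ns /side; case: leqP.
have ns_le : ns%:R <= 2 * n by rewrite nsE eff_size_ge.
(* With [eps1 = C * gamma] the mixing condition reduces to (1 - x)^-1 - 1 <= 4 (C gamma)^2, which
   follows from (1 - x)^-1 - 1 <= 2 x and [x_mix]. *)
apply: (@maximin_power_le R p n1 n2 tau rho0 C gamma alpha beta c0 omega mu1 mu2
  side m g (C * gamma) eps) => //; rewrite -?/delta ?delta2 ?(ltW C0) ?(ltW gamma0)//.
- by rewrite -(ltr_pXn2r (n := 2)) ?nnegrE ?(ltW delta0)// delta2 expr1n; lra.
- have : delta < (1 - rho0) / 2; last by lra.
  by rewrite -(ltr_pXn2r (n := 2)) ?nnegrE ?(ltW delta0)// ?delta2//; lra.
- exact: mulr_gt0.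
- have Cg0 : 0 < C * gamma by exact: mulr_gt0.
  rewrite ler_pdivrMl// [leRHS]mulr_natl [leRHS]mulr2n lerD2l ler_pdivrMr ?mulr_gt0//.
  have y0 : 0 < 1 - x by lra.
  apply: (@le_trans _ _ (2 * x)); last by move: x_mix; rewrite expr2; lra.
  by rewrite lerBlDr -[(1 - x)^-1]mul1r ler_pdivrMr//; nra.
have y0 : 0 < 1 - x by lra.
have y1 : 1 - x <= 1 by lra.
set T := (1 - x) ^- _.
have T0 : 0 <= T by rewrite invr_ge0 exprn_ge0// ltW.
have T1 : 1 <= T.
  by rewrite invf_ge1 ?exprn_gt0// exprn_ile1// ltW.
(* The exponent is at most 2 x (2 n) = 8 c0 ln q = (u / 2) ln q, and q <= P^2. *)
have T_le : T <= P `^ u.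
  apply: (le_trans (inv_pow_le_expR _ _)); first by rewrite ltW.
  apply: (@le_trans _ _ (q `^ (u / 2))).
    rewrite -[q]lnK ?posrE// -expRM ler_expR.
    apply: (@le_trans _ _ (2 * x * (2 * n))).
      by rewrite ler_pM2l// mulr_gt0.
    rewrite le_eqVlt; apply/orP; left; apply/eqP.
    by rewrite /x -/q /c0; field; rewrite gt_eqF.
  by apply: le_trans (qpow _ _) _; [lra|rewrite mulrCA divff ?mulr1].
(* The m-th power is at most exp(m T / g^2); inserting [Pg] in the form 1 / g <= 4 m / P makes the
   exponent at most 16 m^3 T / P^2 <= 16 P^(-u). *)
have V_le : (1 + (T - 1) / g%:R ^+ 2) ^+ m <= 1 + 4 * eps ^+ 2.
  apply: (@le_trans _ _ (expR (m%:R * (T / g%:R ^+ 2)))).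
    rewrite expRM_natl lerXn2r ?nnegrE ?expR_ge0//.
      by rewrite addr_ge0// divr_ge0 ?sqr_ge0 ?subr_ge0.
    apply: (le_trans _ (expR_ge1Dx _)); rewrite lerD2l ler_pM2r ?invr_gt0 ?exprn_gt0//.
    by lra.
  rewrite -ler_ln ?posrE ?expR_gt0//; last by rewrite ltr_wpDr// mulr_ge0 ?sqr_ge0.
  rewrite expRK; apply: (@le_trans _ _ (16 * P `^ (- u))); last first.
    by rewrite mulrC -ler_pdivlMr.
  have -> : P `^ (- u) = P `^ (2 * (1 - beta)) ^+ 3 * P `^ u / P ^+ 2.
    rewrite -powR_mulrn ?powR_ge0// -powRrM -(powR_mulrn 2) ?(ltW P0)// -powRN.
    rewrite -!powRD ?(gt_eqF P0) ?implybT//; congr (_ `^ _).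
    by rewrite /u; ring.
  apply: (@le_trans _ _ (16 * (m%:R ^+ 3 * T / P ^+ 2))).
    rewrite (_ : 16 * _ = m%:R * (T * (16 * m%:R ^+ 2 / P ^+ 2))); last by field; rewrite gt_eqF.
    rewrite ler_pM2l// ler_wpM2l// ler_pdivlMr ?exprn_gt0//.
    rewrite mulrC ler_pdivrMr ?exprn_gt0//.
    have : P ^+ 2 <= (4 * m%:R * g%:R) ^+ 2.
      by rewrite lerXn2r ?nnegrE ?(ltW P0)// (le_trans (ltW P0) Pg).
    by rewrite !exprMn; lra.
  rewrite ler_pM2l// ler_pM2r ?invr_gt0 ?exprn_gt0//.
  by rewrite ler_pM ?exprn_ge0 ?(ltW m0)// lerXn2r ?nnegrE ?powR_ge0 ?(ltW m0).
apply: (@le_trans _ _ (alpha + eps + eps)); last by rewrite /eps; lra.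
rewrite lerD2l ler_pdivrMr; last exact: mulr_gt0.
rewrite -/T -/ns; set V := (_ ^+ m) in V_le *; move: V V_le => V V_le; lra.
Qed.

End large_dimension.

Unset Implicit Arguments.

Theorem theorem3 (R : realType) (xi alpha tau rho0 C gamma omega beta : R)
    (hxi : 0 < xi < 2) (halpha : 0 < alpha < 1)
    (htau : 0 < tau < 1) (hrho0 : 0 < rho0 < 1)
    (hC : 0 < C) (hgamma : 0 < gamma < 1)
    (homega : 0 < omega < 1 - alpha)
    (hbeta : Order.max (2 / 3) ((3 - xi) / 4) < beta < 1) :
  exists2 c0 : R, 0 < c0 &
    forall (n1 n2 p : nat -> nat) (kappa : R)
           (mu1 mu2 : forall k, (p k).-tuple R),
      assumption1B xi n1 n2 p ->
      (fun k => (n1 k)%:R / (n1 k + n2 k)%:R : R) @ \oo --> kappa ->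
      \forall k \near \oo,
        (maximin_power (n1 k) (n2 k) tau rho0 C gamma alpha
           (mu1 k) (mu2 k) beta c0 <= (1 - omega)%:E)%E.
Proof.
have /andP[xi0 _] := hxi; have /andP[_ rho1] := hrho0.
have /andP[gamma0 _] := hgamma; have /andP[_ omega1] := homega.
have /andP[+ beta1] := hbeta; rewrite gt_max => /andP[beta23 _].
pose u := 3 * beta - 2; have u0 : 0 < u by rewrite /u; lra.
pose eps := (1 - omega - alpha) / 2; have eps0 : 0 < eps by rewrite /eps; lra.
exists (u / 16); first by rewrite divr_gt0.
move=> n1 n2 p kappa mu1 mu2 [n_oo p_oo [c1 [c2 [c10 _ c12]]]] _.
pose P k : R := (p k)%:R.
have P_oo : P @ \oo --> +oo by apply/cvgrnyP.
(* The three upper bounds on [x] required in [maximin_power_large]; the extra factor 1/2 in the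
   second makes that one strict. *)
pose eta := minr 2^-1 (minr (((1 - rho0) / 2) ^+ 2 / 2) (2 * (C * gamma) ^+ 2)).
have eta0 : 0 < eta.
  by rewrite !lt_min invr_gt0 ltr0n/= !(mulr_gt0, exprn_gt0, divr_gt0)// subr_gt0.
(* From ln q <= 2 ln P <= (4 / xi) P^(xi / 2) and n >= c1 P^xi, the quantity (u / 8) ln q / n is at
   most K P^(-xi / 2). Half of the power of [P] pays for the logarithm. *)
pose K := u / 2 / (xi * c1).
have K0 : 0 < K by rewrite !(divr_gt0, mulr_gt0).
near=> k.
have p2 : (2 <= p k)%N by near: k; exact: (cvgnyPge _).1.
have P2 : 2 <= P k by rewrite ler_nat.
have P0 : 0 < P k by lra.
have n_ge : c1 * P k `^ xi <= eff_size R (n1 k) (n2 k).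
  by have /andP[+ _] := c12 k; rewrite ler_pdivlMr// powR_gt0.
have n0 : 0 < eff_size R (n1 k) (n2 k).
  by apply: lt_le_trans n_ge; rewrite mulr_gt0// powR_gt0.
have x_eta : 2 * (u / 16) * ln (nb_cov (p k))%:R / eff_size R (n1 k) (n2 k) <= eta.
  have /andP[q2 qp2] := nb_cov_bounds p2.
  apply: (@le_trans _ _ (K * P k `^ (- (xi / 2)))); last first.
    rewrite -ler_pdivlMl//; near: k; apply: near_powRN_le => //.
      by rewrite divr_gt0.
    by rewrite mulr_gt0 ?invr_gt0.
  have lnq : ln (nb_cov (p k))%:R <= 2 * ((xi / 2)^-1 * P k `^ (xi / 2)).
    apply: (@le_trans _ _ (ln (P k ^+ 2))).
      have q_gt0 : 0 < (nb_cov (p k))%:R :> R by rewrite ltr0n (leq_trans _ q2).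
      have P2_gt0 : 0 < P k ^+ 2 by exact: exprn_gt0.
      by rewrite ler_ln ?posrE// /P -natrX ler_nat.
    rewrite lnXn// -[leLHS]mulr_natl ler_pM2l// ln_le_powR//; first by lra.
    by rewrite divr_gt0.
  rewrite ler_pdivrMr//.
  apply: (@le_trans _ _ (K * P k `^ (- (xi / 2)) * (c1 * P k `^ xi))); last first.
    by rewrite ler_wpM2l// mulr_ge0 ?powR_ge0// ltW.
  have -> : P k `^ xi = P k `^ (xi / 2) * P k `^ (xi / 2).
    rewrite -powRD; last by rewrite (gt_eqF P0) implybT.
    by congr (_ `^ _); field.
  rewrite powRN; set a := P k `^ (xi / 2).
  have a0 : 0 < a by exact: powR_gt0.
  rewrite [leRHS](_ : _ = 2 * (u / 16) * (2 * ((xi / 2)^-1 * a))); last first.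
    by rewrite /K; field; rewrite !gt_eqF.
  by rewrite ler_pM2l// mulr_gt0// divr_gt0.
move: x_eta; rewrite !le_min => /and3P[x1 x2 x3].
apply: maximin_power_large => //.
- near: k; apply: near_powRN_le => //; lra.
- by apply: le_lt_trans x2 _; rewrite ltr_pdivrMr// ltr_pMr ?exprn_gt0 ?divr_gt0 ?subr_gt0// ltr1n.
- near: k; apply: near_powRN_le => //.
  by rewrite divr_gt0// ln_gt0// ltrDl mulr_gt0 ?exprn_gt0.
Unshelve. all: by end_near. Qed.
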